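(* Let $k$ be an algebraically closed field of characteristic $0$ and let $n>1$. Every quadratic hypersurface $X\subset \mathbb{P}^n_k$ (the zero set of a nonzero homogeneous polynomial of degree $2$ in $k[x_0,\dots,x_n]$) is $\mathbb{L}$-rational, i.e. $[X]\equiv 1\pmod{\mathbb{L}}$ in $K_0(\mathrm{Var}_k)$.
   Context: $K_0(\mathrm{Var}_k)$ is the Grothendieck ring of varieties over $k$: the abelian group generated by isomorphism classes $[X]$ of $k$-varieties (not necessarily irreducible), modulo $[X]=[Y]+[X\setminus Y]$ for every closed subvariety $Y\subseteq X$, with product $[X]\cdot[Y]=[X\times_k Y]$. $\mathbb{L}=[\mathbb{A}^1_k]$. A $k$-variety $X$ is called $\mathbb{L}$-rational if $[X]-1$ lies in the ideal $(\mathbb{L})\subset K_0(\mathrm{Var}_k)$. Zero loci in projective space are considered as sets of zeros (reduced structure). The hypersurface may be singular, reducible, or defined by a non-reduced equation. *)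

(* Defs.v *)
From HB Require Import structures.
From mathcomp Require Import all_boot all_order all_algebra.
From mathcomp Require Import boolp classical_sets.
From mathcomp Require Import mpoly freeg.

Set Implicit Arguments.
Unset Strict Implicit.
Unset Printing Implicit Defensive.

Import GRing.Theory.
Local Open Scope classical_set_scope.
Local Open Scope ring_scope.

Section Spaces.
Variable k : closedFieldType.

(* Varieties are treated in the classical language, as spaces with functions:
   a topological space with a sheaf of k-valued functions.  Over an
   algebraically closed field this is the category of reduced separated
   k-schemes of finite type (seen through their closed points).  A section on U
   is represented by any of its extensions to the whole space (see s_reg_ext), and
   s_reg U is only relevant for U open. *)
Record structure (T : Type) := Structure {
  s_op : set (set T);
  s_reg : set T -> set (T -> k);
  s_opT : s_op setT;
  s_opI : forall U V, s_op U -> s_op V -> s_op (U `&` V);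
  s_op_bigcup : forall F : set (set T),
    F `<=` s_op -> s_op (\bigcup_(U in F) U);
  s_reg_ext : forall U f g,
    (forall x, U x -> f x = g x) -> s_reg U f -> s_reg U g;
  s_reg_res : forall U V f, s_op V -> V `<=` U -> s_reg U f -> s_reg V f;
  s_reg_glue : forall U f, s_op U ->
    (forall x, U x -> exists V, [/\ s_op V, V x, V `<=` U & s_reg V f]) ->
    s_reg U f;
  s_reg_cst : forall U c, s_op U -> s_reg U (fun=> c);
  s_regD : forall U f g,
    s_reg U f -> s_reg U g -> s_reg U (fun x => f x + g x);
  s_regM : forall U f g,
    s_reg U f -> s_reg U g -> s_reg U (fun x => f x * g x);
  s_reg_inv : forall U f, s_op U -> s_reg U f ->
    s_op (U `&` [set x | f x != 0]) /\
    s_reg (U `&` [set x | f x != 0]) (fun x => (f x)^-1) }.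

Record space := Space { pt :> Type; str : structure pt }.

Definition op (X : space) : set (set X) := s_op (str X).
Definition reg (X : space) : set X -> set (X -> k) := s_reg (str X).

Section SpaceTheory.
Variable X : space.
Implicit Types (U V : set X) (f g : X -> k).

Lemma opT : op (setT : set X).
Proof. exact: s_opT. Qed.

Lemma opI U V : op U -> op V -> op (U `&` V).
Proof. exact: s_opI. Qed.

Lemma op_bigcup (F : set (set X)) :
  F `<=` @op X -> op (\bigcup_(U in F) U).
Proof. exact: s_op_bigcup. Qed.

Lemma reg_ext U f g : (forall x, U x -> f x = g x) -> reg U f -> reg U g.
Proof. exact: s_reg_ext. Qed.

Lemma reg_res U V f : op V -> V `<=` U -> reg U f -> reg V f.
Proof. exact: s_reg_res. Qed.

Lemma reg_glue U f : op U ->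
  (forall x, U x -> exists V, [/\ op V, V x, V `<=` U & reg V f]) -> reg U f.
Proof. exact: s_reg_glue. Qed.

Lemma reg_cst U c : op U -> reg U (fun=> c).
Proof. exact: s_reg_cst. Qed.

Lemma regD U f g : reg U f -> reg U g -> reg U (fun x => f x + g x).
Proof. exact: s_regD. Qed.

Lemma regM U f g : reg U f -> reg U g -> reg U (fun x => f x * g x).
Proof. exact: s_regM. Qed.

Lemma reg_inv U f : op U -> reg U f ->
  op (U `&` [set x | f x != 0]) /\
  reg (U `&` [set x | f x != 0]) (fun x => (f x)^-1).
Proof. exact: s_reg_inv. Qed.

End SpaceTheory.

Definition zclosed (X : space) (Z : set X) := op (~` Z).

Definition morph (X Y : space) (f : X -> Y) :=
  (forall V, op V -> op (f @^-1` V)) /\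
  (forall V h, op V -> reg V h -> reg (f @^-1` V) (h \o f)).

Definition iso (X Y : space) := exists (f : X -> Y) (g : Y -> X),
  [/\ morph f, morph g, cancel f g & cancel g f].

Lemma op_local (X : space) (W : set X) :
  (forall x, W x -> exists U, [/\ op U, U x & U `<=` W]) -> op W.
Proof.
move=> h.
have -> : W = \bigcup_(U in [set U | op U /\ U `<=` W]) U.
  apply/seteqP; split=> x.
    by move=> /h[U [oU Ux UW]]; exists U.
  by move=> [U [_ UW] /UW].
by apply: op_bigcup => U [].
Qed.

Lemma op0 (X : space) : op (set0 : set X).
Proof. by apply: op_local. Qed.

Lemma regN0 (X : space) (U : set X) f : op U -> reg U f ->
  op (U `&` [set x | f x != 0]).
Proof. by move=> oU /(reg_inv oU)[]. Qed.

Lemma morph_id (X : space) : morph (@id X).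
Proof. by split. Qed.

Lemma morph_comp (X Y Z : space) (f : X -> Y) (g : Y -> Z) :
  morph f -> morph g -> morph (g \o f).
Proof.
move=> [f1 f2] [g1 g2]; split=> [V oV|V h oV rh].
  exact: (f1 (g @^-1` V) (g1 _ oV)).
exact: (f2 (g @^-1` V) (h \o g) (g1 _ oV) (g2 _ _ oV rh)).
Qed.

Lemma morph_cst (X Y : space) (y : Y) : morph (fun _ : X => y).
Proof.
have o V : op ((fun _ : X => y) @^-1` V).
  apply: op_local => x Vy; exists setT; split=> //; exact: opT.
split=> // V h oV rh.
exact: reg_cst.
Qed.

Lemma morph_eq (X Y : space) (f g : X -> Y) : f =1 g -> morph f -> morph g.
Proof. by move=> /funext ->. Qed.

Lemma iso_refl X : iso X X.
Proof. by exists id, id; split=> //; exact: morph_id. Qed.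

Lemma iso_sym X Y : iso X Y -> iso Y X.
Proof. by move=> [f [g [*]]]; exists g, f; split. Qed.

Lemma iso_trans X Y Z : iso X Y -> iso Y Z -> iso X Z.
Proof.
move=> [f [g [mf mg fg gf]]] [f' [g' [mf' mg' fg' gf']]].
exists (f' \o f), (g \o g'); split; try exact: morph_comp.
  exact: can_comp.
exact: can_comp.
Qed.

(* The structure induced on an arbitrary subset. *)
Section Sub.
Variables (X : space) (S : set X).

Definition sub_op : set (set (set_type S)) :=
  [set W | exists2 U, op U & W = val @^-1` U].

Definition sub_reg (W : set (set_type S)) : set (set_type S -> k) :=
  [set f | forall x, W x -> exists U g, [/\ op U, reg U g, U (val x) &
     forall y, U (val y) -> W y -> f y = g (val y)]].

Lemma sub_op_local W :
  (forall x, W x -> exists U, [/\ op U, U (val x) & val @^-1` U `<=` W]) ->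
  sub_op W.
Proof.
move=> h; exists (\bigcup_(U in [set U | op U /\ val @^-1` U `<=` W]) U).
  by apply: op_bigcup => U [].
apply/seteqP; split=> x.
  by move=> /h[U [oU Ux UW]]; exists U.
by move=> [U [_ UW] /UW].
Qed.

Lemma sub_opT : sub_op setT.
Proof. by exists setT => //; exact: opT. Qed.

Lemma sub_opI U V : sub_op U -> sub_op V -> sub_op (U `&` V).
Proof.
by move=> [U' oU ->] [V' oV ->]; exists (U' `&` V'); [exact: opI|].
Qed.

Lemma sub_op_bigcup (F : set (set (set_type S))) :
  F `<=` sub_op -> sub_op (\bigcup_(U in F) U).
Proof.
move=> h; apply: sub_op_local => x [W FW Wx].
have [U oU e] := h _ FW; exists U; split=> //; first by rewrite e in Wx.
by rewrite -e => y Wy; exists W.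
Qed.

Lemma sub_reg_ext U f g :
  (forall x, U x -> f x = g x) -> sub_reg U f -> sub_reg U g.
Proof.
move=> fg h x Ux; have [V [r [oV rV Vx e]]] := h x Ux.
by exists V, r; split=> // y Vy Uy; rewrite -fg // e.
Qed.

Lemma sub_reg_res U V f : sub_op V -> V `<=` U -> sub_reg U f -> sub_reg V f.
Proof.
move=> _ VU h x Vx; have [W [r [oW rW Wx e]]] := h x (VU _ Vx).
by exists W, r; split=> // y Wy Vy; rewrite e //; apply: VU.
Qed.

Lemma sub_reg_glue U f : sub_op U ->
  (forall x, U x -> exists V, [/\ sub_op V, V x, V `<=` U & sub_reg V f]) ->
  sub_reg U f.
Proof.
move=> oU h x Ux; have [V [[V' oV' eV] Vx VU rV]] := h x Ux.
have [W [r [oW rW Wx e]]] := rV x Vx.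
exists (W `&` V'), r; split.
- exact: opI.
- by apply: reg_res rW; [exact: opI|move=> ? []].
- by split=> //; rewrite eV in Vx.
- by move=> y [Wy Vy] Uy; rewrite e // eV.
Qed.

Lemma sub_reg_cst U c : sub_op U -> sub_reg U (fun=> c).
Proof.
move=> _ x _; exists setT, (fun=> c); split=> //; first exact: opT.
exact/reg_cst/opT.
Qed.

Let reg2 (o : k -> k -> k) U f g :
  (forall (V : set X) f g, reg V f -> reg V g -> reg V (fun x => o (f x) (g x))) ->
  sub_reg U f -> sub_reg U g -> sub_reg U (fun x => o (f x) (g x)).
Proof.
move=> ho hf hg x Ux.
have [V [r [oV rV Vx e]]] := hf x Ux.
have [V' [r' [oV' rV' Vx' e']]] := hg x Ux.
exists (V `&` V'), (fun x => o (r x) (r' x)); split=> //.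
- exact: opI.
- apply: ho; [apply: reg_res rV|apply: reg_res rV'].
  + exact: opI.
  + by move=> ? [].
  + exact: opI.
  + by move=> ? [].
- by move=> y [Vy V'y] Uy; rewrite e // e'.
Qed.

Lemma sub_regD U f g :
  sub_reg U f -> sub_reg U g -> sub_reg U (fun x => f x + g x).
Proof. by apply: reg2 => V ? ?; exact: regD. Qed.

Lemma sub_regM U f g :
  sub_reg U f -> sub_reg U g -> sub_reg U (fun x => f x * g x).
Proof. by apply: reg2 => V ? ?; exact: regM. Qed.

Lemma sub_reg_inv U f : sub_op U -> sub_reg U f ->
  sub_op (U `&` [set x | f x != 0]) /\
  sub_reg (U `&` [set x | f x != 0]) (fun x => (f x)^-1).
Proof.
move=> [U' oU' eU] rf; split.
  apply: sub_op_local => x [Ux fx].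
  have [V [r [oV rV Vx e]]] := rf x Ux.
  exists (U' `&` (V `&` [set x | r x != 0])); split.
  - by apply: opI => //; exact: regN0.
  - by rewrite eU in Ux; split=> //; split=> //=; rewrite -e // eU.
  - move=> y [Uy [Vy ry]]; have Uy' : U y by rewrite eU.
    by split=> //=; rewrite e.
move=> x [Ux fx].
have [V [r [oV rV Vx e]]] := rf x Ux.
have [oV' rV'] := reg_inv oV rV.
exists (V `&` [set x | r x != 0]), (fun x => (r x)^-1); split=> //.
  by split=> //=; rewrite -e.
by move=> y [Vy ry] [Uy fy]; rewrite e.
Qed.

Definition sub : space := Space (Structure sub_opT sub_opI sub_op_bigcup sub_reg_ext
  sub_reg_res sub_reg_glue sub_reg_cst sub_regD sub_regM sub_reg_inv).

Lemma morph_val : morph (val : sub -> X).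
Proof.
split=> [V oV|V h oV rh]; first by exists V.
by move=> x Vx; exists V, h.
Qed.

Lemma morph_sub (T : space) (f : T -> sub) :
  morph ((val : sub -> X) \o f) -> morph f.
Proof.
move=> [f1 f2]; split=> [V [U oU ->]|V h [U oU eV] rh]; first exact: f1.
apply: reg_glue.
  by rewrite eV; exact: f1.
move=> x Vx; have [W [g [oW rW Wx e]]] := rh _ Vx.
exists (((val : sub -> X) \o f) @^-1` (U `&` W)); split.
- by apply: f1; exact: opI.
- by split=> //; move: Vx; rewrite /preimage /= eV.
- by move=> y [Uy Wy]; rewrite /preimage /= eV.
- apply: reg_ext (f2 (U `&` W) g _ _).
  + by move=> y [Uy Wy] /=; rewrite e // eV.
  + exact: opI.
  + by apply: reg_res rW; [exact: opI|move=> ? []].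
Qed.

Definition to_sub (T : Type) (f : T -> X) (hf : forall t, S (f t)) (t : T) : sub
  := exist _ (f t) (mem_set (hf t)).

Lemma morph_to_sub (T : space) (f : T -> X) (hf : forall t, S (f t)) :
  morph f -> morph (to_sub hf : T -> sub).
Proof. by move=> mf; apply: morph_sub. Qed.

Lemma subP (x : sub) : S (val x).
Proof. exact: set_mem (valP x). Qed.

End Sub.
Arguments to_sub {X} S {T f} hf t.

(* The categorical product: W is open (resp. h is regular on W) when it is so
   after pulling back along every pair of morphisms Z -> X, Z -> Y.  See
   morph_fst, morph_snd and morph_pair for the universal property. *)
Section Prod.
Variables X Y : space.
Notation XY := (X * Y)%type.

Definition pair_map (Z : Type) (f : Z -> X) (g : Z -> Y) z : XY := (f z, g z).

Definition prod_op : set (set XY) :=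
  [set W | forall (Z : space) (f : Z -> X) (g : Z -> Y), morph f -> morph g ->
     op (pair_map f g @^-1` W)].

Definition prod_reg (W : set XY) : set (XY -> k) :=
  [set h : XY -> k |
     forall (Z : space) (f : Z -> X) (g : Z -> Y), morph f -> morph g ->
     reg (pair_map f g @^-1` W) (h \o pair_map f g)].

Lemma prod_opT : prod_op setT.
Proof. by move=> *; exact: opT. Qed.

Lemma prod_opI U V : prod_op U -> prod_op V -> prod_op (U `&` V).
Proof.
by move=> oU oV Z f g mf mg; apply: opI; [exact: oU|exact: oV].
Qed.

Lemma prod_op_bigcup (F : set (set XY)) :
  F `<=` prod_op -> prod_op (\bigcup_(U in F) U).
Proof.
move=> h Z f g mf mg; apply: op_local => z [U FU Uz].
exists (pair_map f g @^-1` U); split=> //; first exact: h.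
by move=> t Ut; exists U.
Qed.

Lemma prod_reg_ext U f g :
  (forall x, U x -> f x = g x) -> prod_reg U f -> prod_reg U g.
Proof.
move=> fg rf Z a b ma mb; apply: reg_ext (rf Z a b ma mb).
by move=> z Uz; exact: fg.
Qed.

Lemma prod_reg_res U V f : prod_op V -> V `<=` U -> prod_reg U f -> prod_reg V f.
Proof.
move=> oV VU rf Z a b ma mb; apply: reg_res (rf Z a b ma mb); first exact: oV.
by move=> z; exact: VU.
Qed.

Lemma prod_reg_glue U f : prod_op U ->
  (forall x, U x -> exists V, [/\ prod_op V, V x, V `<=` U & prod_reg V f]) ->
  prod_reg U f.
Proof.
move=> oU h Z a b ma mb; apply: reg_glue; first exact: oU.
move=> z Uz; have [V [oV Vz VU rV]] := h _ Uz.
exists (pair_map a b @^-1` V); split=> //; first exact: oV.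
  by move=> t; exact: VU.
exact: rV.
Qed.

Lemma prod_reg_cst U c : prod_op U -> prod_reg U (fun=> c).
Proof. by move=> oU Z f g mf mg; apply: reg_cst; exact: oU. Qed.

Lemma prod_regD U f g :
  prod_reg U f -> prod_reg U g -> prod_reg U (fun x => f x + g x).
Proof.
by move=> rf rg Z a b ma mb; apply: (regD (rf Z a b ma mb) (rg Z a b ma mb)).
Qed.

Lemma prod_regM U f g :
  prod_reg U f -> prod_reg U g -> prod_reg U (fun x => f x * g x).
Proof.
by move=> rf rg Z a b ma mb; apply: (regM (rf Z a b ma mb) (rg Z a b ma mb)).
Qed.

Lemma prod_reg_inv U f : prod_op U -> prod_reg U f ->
  prod_op (U `&` [set x | f x != 0]) /\
  prod_reg (U `&` [set x | f x != 0]) (fun x => (f x)^-1).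
Proof.
move=> oU rf; split=> Z a b ma mb;
  by have [] := reg_inv (oU Z a b ma mb) (rf Z a b ma mb).
Qed.

Definition prod_space : space := Space (Structure prod_opT prod_opI prod_op_bigcup
  prod_reg_ext prod_reg_res prod_reg_glue prod_reg_cst prod_regD prod_regM
  prod_reg_inv).

Lemma morph_fst : morph (fst : prod_space -> X).
Proof.
split=> [V oV Z f g mf mg|V h oV rh Z f g mf mg]; first exact: mf.1.
exact: (mf.2 _ _ oV rh).
Qed.

Lemma morph_snd : morph (snd : prod_space -> Y).
Proof.
split=> [V oV Z f g mf mg|V h oV rh Z f g mf mg]; first exact: mg.1.
exact: (mg.2 _ _ oV rh).
Qed.

Lemma morph_pair (Z : space) (f : Z -> X) (g : Z -> Y) :
  morph f -> morph g -> morph (pair_map f g : Z -> prod_space).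
Proof.
by move=> mf mg; split=> [V oV|V h oV rh]; [exact: oV|exact: rh].
Qed.

End Prod.

(* The space whose regular functions are locally quotients p / q of two elements
   of some R d, for a family R of sets of functions that is graded in the
   following sense. *)
Record graded (T : Type) (R : nat -> set (T -> k)) : Prop := Graded {
  gr_cst : forall c, R 0%N (fun=> c);
  gr_add : forall d p q, R d p -> R d q -> R d (fun x => p x + q x);
  gr_mul : forall d e p q,
    R d p -> R e q -> R (d + e)%N (fun x => p x * q x) }.

Section Frac.
Variables (T : Type) (R : nat -> set (T -> k)) (gR : graded R).

Definition frac_op : set (set T) := [set W | forall x, W x ->
  exists d q, [/\ R d q, q x != 0 & forall y, q y != 0 -> W y]].

Definition frac_reg (W : set T) : set (T -> k) := [set f | forall x, W x ->
  exists d p q, [/\ R d p, R d q, q x != 0 &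
    forall y, W y -> q y != 0 -> f y = p y / q y]].

Lemma frac_opT : frac_op setT.
Proof.
by move=> x _; exists 0%N, (fun=> 1); split=> //; [exact: gr_cst|exact: oner_neq0].
Qed.

Lemma frac_opI U V : frac_op U -> frac_op V -> frac_op (U `&` V).
Proof.
move=> oU oV x [Ux Vx].
have [d [q [Rq qx qU]]] := oU x Ux; have [e [r [Rr rx rV]]] := oV x Vx.
exists (d + e)%N, (fun x => q x * r x); split; first exact: gr_mul.
  by rewrite mulf_neq0.
by move=> y; rewrite mulf_eq0 negb_or => /andP[/qU ? /rV].
Qed.

Lemma frac_op_bigcup (F : set (set T)) :
  F `<=` frac_op -> frac_op (\bigcup_(U in F) U).
Proof.
move=> h x [U FU Ux]; have [d [q [Rq qx qU]]] := h _ FU x Ux.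
by exists d, q; split=> // y /qU Uy; exists U.
Qed.

Lemma frac_reg_ext U f g :
  (forall x, U x -> f x = g x) -> frac_reg U f -> frac_reg U g.
Proof.
move=> fg rf x Ux; have [d [p [q [Rp Rq qx e]]]] := rf x Ux.
by exists d, p, q; split=> // y Uy qy; rewrite -fg // e.
Qed.

Lemma frac_reg_res U V f : frac_op V -> V `<=` U -> frac_reg U f -> frac_reg V f.
Proof.
move=> _ VU rf x Vx; have [d [p [q [Rp Rq qx e]]]] := rf x (VU _ Vx).
by exists d, p, q; split=> // y Vy qy; rewrite e //; exact: VU.
Qed.

Lemma frac_reg_glue U f : frac_op U ->
  (forall x, U x -> exists V, [/\ frac_op V, V x, V `<=` U & frac_reg V f]) ->
  frac_reg U f.
Proof.
move=> oU h x Ux; have [V [oV Vx VU rV]] := h x Ux.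
have [d [p [q [Rp Rq qx e]]]] := rV x Vx.
have [d' [r [Rr rx rV']]] := oV x Vx.
exists (d + d')%N, (fun x => p x * r x), (fun x => q x * r x); split.
- exact: gr_mul.
- exact: gr_mul.
- by rewrite mulf_neq0.
- move=> y Uy; rewrite mulf_eq0 negb_or => /andP[qy ry].
  by rewrite -mulf_div divff // mulr1 e //; exact: rV'.
Qed.

Lemma frac_reg_cst U c : frac_op U -> frac_reg U (fun=> c).
Proof.
move=> _ x _; exists 0%N, (fun=> c), (fun=> 1); split; try exact: gr_cst.
  exact: oner_neq0.
by move=> *; rewrite divr1.
Qed.

Lemma frac_regD U f g :
  frac_reg U f -> frac_reg U g -> frac_reg U (fun x => f x + g x).
Proof.
move=> rf rg x Ux.
have [d [p [q [Rp Rq qx e]]]] := rf x Ux.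
have [d' [p' [q' [Rp' Rq' qx' e']]]] := rg x Ux.
exists (d + d')%N, (fun x => p x * q' x + q x * p' x), (fun x => q x * q' x).
split.
- by apply: gr_add => //; exact: gr_mul.
- exact: gr_mul.
- by rewrite mulf_neq0.
- move=> y Uy; rewrite mulf_eq0 negb_or => /andP[qy qy'].
  by rewrite e // e' // addf_div // (mulrC (p' y)).
Qed.

Lemma frac_regM U f g :
  frac_reg U f -> frac_reg U g -> frac_reg U (fun x => f x * g x).
Proof.
move=> rf rg x Ux.
have [d [p [q [Rp Rq qx e]]]] := rf x Ux.
have [d' [p' [q' [Rp' Rq' qx' e']]]] := rg x Ux.
exists (d + d')%N, (fun x => p x * p' x), (fun x => q x * q' x).
split; try exact: gr_mul.
  by rewrite mulf_neq0.
move=> y Uy; rewrite mulf_eq0 negb_or => /andP[qy qy'].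
by rewrite e // e' // mulf_div.
Qed.

Lemma frac_reg_inv U f : frac_op U -> frac_reg U f ->
  frac_op (U `&` [set x | f x != 0]) /\
  frac_reg (U `&` [set x | f x != 0]) (fun x => (f x)^-1).
Proof.
move=> oU rf; split=> x [Ux fx].
  have [d [p [q [Rp Rq qx e]]]] := rf x Ux.
  have [d' [r [Rr rx rU]]] := oU x Ux.
  have px : p x != 0.
    by move: fx => /=; rewrite e // mulf_eq0 negb_or => /andP[].
  exists (d + d + d')%N, (fun x => p x * q x * r x); split.
  - by do 2 apply: gr_mul => //.
  - by rewrite !mulf_neq0.
  - move=> y; rewrite !mulf_eq0 !negb_or => /andP[/andP[py qy] /rU Uy].
    by split=> //=; rewrite e // mulf_neq0 ?invr_eq0.
have [d [p [q [Rp Rq qx e]]]] := rf x Ux.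
have px : p x != 0.
  by move: fx => /=; rewrite e // mulf_eq0 negb_or => /andP[].
exists (d + d)%N, (fun x => q x * q x), (fun x => p x * q x).
split; try exact: gr_mul.
  by rewrite mulf_neq0.
move=> y [Uy fy]; rewrite mulf_eq0 negb_or => /andP[py qy].
by rewrite e // invf_div -mulf_div divff // mulr1.
Qed.

Definition frac_space : space := Space (Structure frac_opT frac_opI frac_op_bigcup
  frac_reg_ext frac_reg_res frac_reg_glue frac_reg_cst frac_regD frac_regM
  frac_reg_inv).

Lemma frac_opN0 d (q : T -> k) : R d q ->
  op ([set x | q x != 0] : set frac_space).
Proof. by move=> Rq x qx; exists d, q. Qed.

Lemma frac_regQ d (p q : T -> k) : R d p -> R d q ->
  reg ([set x | q x != 0] : set frac_space) (fun x => p x / q x).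
Proof. by move=> Rp Rq x qx; exists d, p, q. Qed.

Lemma frac_morph (Z : space) (f : Z -> frac_space) :
  (forall d p q, R d p -> R d q ->
     op [set z | q (f z) != 0] /\
     reg [set z | q (f z) != 0] (fun z => p (f z) / q (f z))) ->
  morph f.
Proof.
move=> h.
have o V : op V -> op (f @^-1` V).
  move=> oV; apply: op_local => z Vz; have [d [q [Rq qx qV]]] := oV _ Vz.
  exists [set z | q (f z) != 0]; split=> //; first exact: (h d q q Rq Rq).1.
  by move=> t; exact: qV.
split=> // V g oV rg; apply: reg_glue; first exact: o.
move=> z Vz; have [d [p [q [Rp Rq qx e]]]] := rg _ Vz.
have [o1 r1] := h d p q Rp Rq.
exists (f @^-1` V `&` [set z | q (f z) != 0]); split=> //.
- by apply: opI => //; exact: o.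
- apply: (@reg_ext _ _ (fun z => p (f z) / q (f z))).
    by move=> t [Vt qt] /=; rewrite e.
  apply: reg_res r1; first by apply: opI => //; exact: o.
  by move=> t [].
Qed.

End Frac.

Definition poly_fun n (d : nat) : set ('rV[k]_n -> k) :=
  [set f : 'rV[k]_n -> k | exists p : {mpoly k[n]}, forall v, f v = p.@[v 0]].

Lemma poly_fun_graded n : graded (@poly_fun n).
Proof.
split=> [c|d f g [p hp] [q hq]|d e f g [p hp] [q hq]].
- by exists c%:MP => v; rewrite mevalC.
- by exists (p + q) => v; rewrite mevalD hp hq.
- by exists (p * q) => v; rewrite mevalM hp hq.
Qed.

Definition affine_space n : space := frac_space (poly_fun_graded n).

(* Points of P^n: the lines of k^(n+1); \vpick x is a nonzero vector of the
   line x, i.e. a vector of homogeneous coordinates.  The functions in form_fun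
   depend on the choice of this vector, but their zeros and the quotients of two
   of them of the same degree do not. *)
Definition proj_pt n := {x : {vspace 'rV[k]_n.+1} | \dim x == 1%N}.

Definition hcoord n (x : proj_pt n) : 'rV[k]_n.+1 := vpick (val x).

Definition form_fun n (d : nat) : set (proj_pt n -> k) :=
  [set f : proj_pt n -> k | exists2 p : {mpoly k[n.+1]},
     p \is d.-homog & forall x, f x = p.@[hcoord x 0]].

Lemma form_fun_graded n : graded (@form_fun n).
Proof.
split=> [c|d f g [p homp hp] [q homq hq]|d e f g [p homp hp] [q homq hq]].
- exists c%:MP; last by move=> v; rewrite mevalC.
  by rewrite -[c%:MP]mulr1 mul_mpolyC; apply/dhomogZ/dhomog1.
- by exists (p + q); [exact: dhomogD|move=> v; rewrite mevalD hp hq].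
- by exists (p * q); [exact: dhomogM|move=> v; rewrite mevalM hp hq].
Qed.

Definition proj_space n : space := frac_space (form_fun_graded n).

Definition is_affine (X : space) :=
  exists n (Z : set (affine_space n)), zclosed Z /\ iso X (sub Z).

Definition is_prevariety (X : space) := exists (I : finType) (U : I -> set X),
  (forall i, op (U i) /\ is_affine (sub (U i))) /\ (forall x, exists i, U i x).

Definition is_separated (X : space) :=
  zclosed ([set p | p.1 = p.2] : set (prod_space X X)).

Definition is_variety (X : space) := is_prevariety X /\ is_separated X.

Record variety := Variety { var_space :> space; varP : is_variety var_space }.

Lemma reg_comp (X Y : space) (f : X -> Y) V h :
  morph f -> op V -> reg V h -> reg (f @^-1` V) (fun x => h (f x)).
Proof. by move=> [_ f2] oV rh; exact: f2. Qed.

Lemma reg_compT (X Y : space) (f : X -> Y) h :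
  morph f -> reg setT h -> reg setT (fun x => h (f x)).
Proof. by move=> mf; apply: (reg_comp mf); exact: opT. Qed.

Lemma regT_opN0 (X : space) (h : X -> k) :
  reg setT h -> op [set x | h x != 0].
Proof. by move=> /(regN0 (@opT X)); rewrite setTI. Qed.

Lemma reg_sub (X : space) (U : set X) f g : op U ->
  reg U f -> reg U g -> reg U (fun x => f x - g x).
Proof.
move=> oU rf rg; apply: regD => //.
apply: (@reg_ext _ _ (fun x => -1 * g x)); first by move=> *; rewrite mulN1r.
by apply: regM => //; exact: reg_cst.
Qed.

Lemma reg_div (X : space) (U : set X) f g : op U ->
  reg U f -> reg U g -> (forall x, U x -> g x != 0) ->
  reg U (fun x => f x / g x).
Proof.
move=> oU rf rg gN0; apply: regM => //.
have [_] := reg_inv oU rg.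
by rewrite (_ : U `&` _ = U) //; apply/seteqP; split=> [x []|x Ux] //; split=> //; exact: gN0.
Qed.

Lemma reg_meval (X : space) (U : set X) n (f : X -> 'I_n -> k)
    (p : {mpoly k[n]}) : op U ->
  (forall i, reg U (fun x => f x i)) -> reg U (fun x => p.@[f x]).
Proof.
move=> oU rf.
have rX m (g : X -> k) : reg U g -> reg U (fun x => g x ^+ m).
  move=> rg; elim: m => [|m IH]; first exact: reg_cst.
  by apply: reg_ext (regM rg IH) => x _; rewrite exprS.
have rP (r : seq 'I_n) (g : X -> 'I_n -> k) : (forall i, reg U (fun x => g x i)) ->
    reg U (fun x => \prod_(i <- r) g x i).
  move=> rg; elim: r => [|i r IH].
    by apply: reg_ext (reg_cst 1 oU) => x _; rewrite big_nil.
  by apply: reg_ext (regM (rg i) IH) => x _; rewrite big_cons.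
have rS (r : seq 'X_{1..n}) (g : X -> 'X_{1..n} -> k) :
    (forall i, reg U (fun x => g x i)) -> reg U (fun x => \sum_(i <- r) g x i).
  move=> rg; elim: r => [|i r IH].
    by apply: reg_ext (reg_cst 0 oU) => x _; rewrite big_nil.
  by apply: reg_ext (regD (rg i) IH) => x _; rewrite big_cons.
apply: (@reg_ext _ _ (fun x => \sum_(m <- msupp p) p@_m * \prod_i f x i ^+ m i)).
  by move=> x _; rewrite mevalE.
apply: rS => m; apply: regM; first exact: reg_cst.
by apply: rP => i; apply: rX.
Qed.

Lemma affine_reg n (p : {mpoly k[n]}) :
  reg (setT : set (affine_space n)) (fun v => p.@[v 0]).
Proof.
move=> x _; exists 0%N, (fun v => p.@[v 0]), (fun=> 1); split.
- by exists p.
- by exists 1 => v; rewrite meval1.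
- exact: oner_neq0.
- by move=> *; rewrite divr1.
Qed.

Lemma affine_reg_coord n i :
  reg (setT : set (affine_space n)) (fun v => v 0 i).
Proof.
by apply: reg_ext (affine_reg 'X_i) => v _; rewrite mevalXU.
Qed.

Lemma morph_affine (X : space) n (f : X -> affine_space n) :
  (forall i, reg setT (fun x => f x 0 i)) -> morph f.
Proof.
move=> rf; apply: frac_morph => d p q [p' hp] [q' hq].
have rp : reg setT (fun x => p (f x)).
  apply: (@reg_ext _ _ (fun x => p'.@[f x 0])); first by move=> x _; rewrite hp.
  exact/reg_meval/rf/opT.
have rq : reg setT (fun x => q (f x)).
  apply: (@reg_ext _ _ (fun x => q'.@[f x 0])); first by move=> x _; rewrite hq.
  exact/reg_meval/rf/opT.
have oq := regT_opN0 rq; split=> //.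
by apply: reg_div => //; [apply: reg_res rp|apply: reg_res rq].
Qed.

Lemma closed_preim (X Y : space) (f : X -> Y) Z :
  morph f -> zclosed Z -> zclosed (f @^-1` Z).
Proof. by move=> [f1 _] cZ; exact: (f1 (~` Z)). Qed.

Lemma closedI (X : space) (A B : set X) :
  zclosed A -> zclosed B -> zclosed (A `&` B).
Proof.
move=> cA cB; rewrite /zclosed setCI; apply: op_local => x [Ax|Bx].
  by exists (~` A); split=> // y; left.
by exists (~` B); split=> // y; right.
Qed.

Lemma closedT (X : space) : zclosed (setT : set X).
Proof. by rewrite /zclosed setCT; exact: op0. Qed.

Lemma iso_prod (X X' Y Y' : space) : iso X X' -> iso Y Y' ->
  iso (prod_space X Y) (prod_space X' Y').
Proof.
move=> [f [f' [mf mf' ff' f'f]]] [g [g' [mg mg' gg' g'g]]].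
have m (A A' B B' : space) (a : A -> A') (b : B -> B') : morph a -> morph b ->
    morph (pair_map (a \o fst) (b \o snd) : prod_space A B -> prod_space A' B').
  move=> ma mb; apply: morph_pair.
    exact: morph_comp (@morph_fst _ _) ma.
  exact: morph_comp (@morph_snd _ _) mb.
exists (pair_map (f \o fst) (g \o snd)), (pair_map (f' \o fst) (g' \o snd)).
split; try exact: m.
  by move=> [x y]; rewrite /pair_map /= ff' gg'.
by move=> [x y]; rewrite /pair_map /= f'f g'g.
Qed.

Lemma iso_prodC (X Y : space) : iso (prod_space X Y) (prod_space Y X).
Proof.
exists (pair_map snd fst), (pair_map snd fst).
by split; try (by case); apply: morph_pair; first [exact: morph_fst|exact: morph_snd].
Qed.

Lemma iso_prodA (X Y Z : space) :
  iso (prod_space X (prod_space Y Z)) (prod_space (prod_space X Y) Z).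
Proof.
exists (fun p : prod_space X (prod_space Y Z) => ((p.1, p.2.1), p.2.2)).
exists (fun p : prod_space (prod_space X Y) Z => (p.1.1, (p.1.2, p.2))).
split; [| |by case=> ? []|by case=> [[]]].
- apply: (morph_pair (f := fun p : prod_space X (prod_space Y Z) =>
    (p.1, p.2.1) : prod_space X Y)); first apply: morph_pair.
  + exact: morph_fst.
  + exact: morph_comp (@morph_snd _ _) (@morph_fst _ _).
  + exact: morph_comp (@morph_snd _ _) (@morph_snd _ _).
- apply: (morph_pair (g := fun p : prod_space (prod_space X Y) Z =>
    (p.1.2, p.2) : prod_space Y Z)); last apply: morph_pair.
  + exact: morph_comp (@morph_fst _ _) (@morph_fst _ _).
  + exact: morph_comp (@morph_fst _ _) (@morph_snd _ _).
  + exact: morph_snd.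
Qed.

Lemma iso_prod1 (X : space) : iso (prod_space (affine_space 0) X) X.
Proof.
exists snd, (fun x => (0 : 'rV[k]_0, x) : prod_space (affine_space 0) X).
split=> //.
- exact: morph_snd.
- by apply: (morph_pair (X := affine_space 0)); [exact: morph_cst|exact: morph_id].
- by move=> [u x]; rewrite /pair_map /=; congr (_, _); apply/rowP => -[].
Qed.

Lemma iso_sub (X Y : space) (f : X -> Y) (g : Y -> X) (S : set X) (T : set Y) :
  morph f -> morph g -> cancel f g -> cancel g f ->
  (forall x, S x -> T (f x)) -> (forall y, T y -> S (g y)) ->
  iso (sub S) (sub T).
Proof.
move=> mf mg fg gf ST TS.
exists (to_sub T (fun x : sub S => ST _ (subP x))).
exists (to_sub S (fun y : sub T => TS _ (subP y))).
split; [| |by move=> x; apply: val_inj => /=|by move=> x; apply: val_inj => /=].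
  apply: morph_to_sub; exact: morph_comp (@morph_val _ _) mf.
apply: morph_to_sub; exact: morph_comp (@morph_val _ _) mg.
Qed.

Lemma iso_subT (X : space) : iso (sub (setT : set X)) X.
Proof.
exists val, (@to_sub X setT X id (fun=> I)); split.
- exact: morph_val.
- by apply: morph_to_sub; exact: morph_id.
- by move=> x; apply: val_inj.
- by [].
Qed.

Lemma iso_sub_fst (X Y : space) (S : set X) :
  iso (prod_space (sub S) Y) (sub (fst @^-1` S : set (prod_space X Y))).
Proof.
have h1 (p : prod_space (sub S) Y) :
    (fst @^-1` S) (pair_map (val \o fst) snd p : prod_space X Y).
  exact: subP p.1.
have h2 (p : sub (fst @^-1` S : set (prod_space X Y))) : S (val p).1.
  exact: subP p.
exists (@to_sub (prod_space X Y) (fst @^-1` S) _ _ h1).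
exists (pair_map (to_sub S h2) (snd \o val)); split.
- apply/morph_to_sub/morph_pair.
    exact: morph_comp (@morph_fst _ _) (@morph_val _ _).
  exact: morph_snd.
- apply: morph_pair; first apply: morph_to_sub.
    exact: morph_comp (@morph_val _ _) (@morph_fst _ _).
  exact: morph_comp (@morph_val _ _) (@morph_snd _ _).
- by move=> [x y]; rewrite /pair_map /=; congr (_, _); apply: val_inj.
- by move=> [[x y] h]; apply: val_inj.
Qed.

Lemma is_affine_iso X Y : iso X Y -> is_affine X -> is_affine Y.
Proof.
move=> XY [n [Z [cZ XZ]]]; exists n, Z; split=> //.
exact: iso_trans (iso_sym XY) XZ.
Qed.

Lemma is_affine_prod X Y : is_affine X -> is_affine Y ->
  is_affine (prod_space X Y).
Proof.
move=> [n [Z [cZ XZ]]] [m [T [cT YT]]].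
pose l (v : affine_space (n + m)) : affine_space n := lsubmx (v : 'rV_(n + m)).
pose r (v : affine_space (n + m)) : affine_space m := rsubmx (v : 'rV_(n + m)).
have ml : morph l.
  apply: morph_affine => i.
  by apply: reg_ext (affine_reg_coord (lshift m i)) => v _; rewrite mxE.
have mr : morph r.
  apply: morph_affine => i.
  by apply: reg_ext (affine_reg_coord (rshift n i)) => v _; rewrite mxE.
exists (n + m)%N, (l @^-1` Z `&` r @^-1` T); split.
  by apply: closedI; exact: closed_preim.
apply: iso_trans (iso_prod XZ YT) _.
pose j (p : prod_space (sub Z) (sub T)) : affine_space (n + m) :=
  row_mx (val p.1 : 'rV_n) (val p.2 : 'rV_m).
have lj p : l (j p) = val p.1 by exact: row_mxKl.
have rj p : r (j p) = val p.2 by exact: row_mxKr.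
have h p : (l @^-1` Z `&` r @^-1` T) (j p).
  by split; rewrite /preimage /= ?lj ?rj; exact: subP.
have h1 (v : sub (l @^-1` Z `&` r @^-1` T)) : Z (l (val v)) by case: (subP v).
have h2 (v : sub (l @^-1` Z `&` r @^-1` T)) : T (r (val v)) by case: (subP v).
exists (to_sub (l @^-1` Z `&` r @^-1` T) h), (pair_map (to_sub Z h1) (to_sub T h2)); split.
- apply/morph_to_sub/morph_affine => i.
  rewrite /j; case: (fintype.splitP i) => [a ia|b ib].
    have -> : i = lshift m a by apply: val_inj.
    apply: (@reg_ext (prod_space (sub Z) (sub T)) _
      (fun p => (val p.1 : 'rV[k]_n) 0 a)); first by move=> x _; rewrite row_mxEl.
    apply: (reg_compT _ (affine_reg_coord a)).
    exact: morph_comp (@morph_fst _ _) (@morph_val _ _).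
  have -> : i = rshift n b by apply: val_inj.
  apply: (@reg_ext (prod_space (sub Z) (sub T)) _
    (fun p => (val p.2 : 'rV[k]_m) 0 b)); first by move=> x _; rewrite row_mxEr.
  apply: (reg_compT _ (affine_reg_coord b)).
  exact: morph_comp (@morph_snd _ _) (@morph_val _ _).
- by apply: morph_pair; apply: morph_to_sub;
    [exact: morph_comp (@morph_val _ _) ml|exact: morph_comp (@morph_val _ _) mr].
- move=> [x y]; rewrite /pair_map /=; congr (_, _); apply: val_inj => /=.
    exact: lj.
  exact: rj.
- by move=> v; apply: val_inj; exact: hsubmxK.
Qed.

Lemma is_prevariety_affine X : is_affine X -> is_prevariety X.
Proof.
move=> aX; exists unit, (fun=> setT); split=> [_|x]; last by exists tt.
split; first exact: opT.
exact: is_affine_iso (iso_sym (iso_subT X)) aX.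
Qed.

Lemma is_prevariety_prod X Y : is_prevariety X -> is_prevariety Y ->
  is_prevariety (prod_space X Y).
Proof.
move=> [I [U [hU cU]]] [J [V [hV cV]]].
exists (I * J)%type, (fun ij => fst @^-1` U ij.1 `&` snd @^-1` V ij.2).
split=> [[i j]|[x y]]; last first.
  by have [i Ui] := cU x; have [j Vj] := cV y; exists (i, j).
have [oU aU] := hU i; have [oV aV] := hV j; split.
  by apply: opI; [exact: (@morph_fst X Y).1 _ oU|exact: (@morph_snd X Y).1 _ oV].
apply: is_affine_iso (is_affine_prod aU aV).
have h (p : prod_space (sub (U i)) (sub (V j))) :
    (fst @^-1` U i `&` snd @^-1` V j) (pair_map (val \o fst) (val \o snd) p : prod_space X Y).
  by split; exact: subP.
have h1 (p : sub (fst @^-1` U i `&` snd @^-1` V j : set (prod_space X Y))) :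
  U i (val p).1 by case: (subP p).
have h2 (p : sub (fst @^-1` U i `&` snd @^-1` V j : set (prod_space X Y))) :
  V j (val p).2 by case: (subP p).
exists (@to_sub (prod_space X Y) (fst @^-1` U i `&` snd @^-1` V j) _ _ h).
exists (pair_map (to_sub (U i) h1) (to_sub (V j) h2)); split.
- apply/morph_to_sub/morph_pair.
    exact: morph_comp (@morph_fst _ _) (@morph_val _ _).
  exact: morph_comp (@morph_snd _ _) (@morph_val _ _).
- apply: morph_pair; apply: morph_to_sub.
    exact: morph_comp (@morph_val _ _) (@morph_fst _ _).
  exact: morph_comp (@morph_val _ _) (@morph_snd _ _).
- by move=> [x y]; rewrite /pair_map /=; congr (_, _); apply: val_inj.
- by move=> [[x y] hp]; apply: val_inj.
Qed.

Lemma is_separated_inj (X Y : space) (f : X -> Y) :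
  morph f -> injective f -> is_separated Y -> is_separated X.
Proof.
move=> mf fI sY.
have mff : morph (pair_map (f \o fst) (f \o snd)
                   : prod_space X X -> prod_space Y Y).
  apply: morph_pair.
    exact: morph_comp (@morph_fst _ _) mf.
  exact: morph_comp (@morph_snd _ _) mf.
have := closed_preim mff sY; rewrite /is_separated.
congr (zclosed _); apply/seteqP; split=> -[x y] /=; first exact: fI.
by rewrite /preimage /= => ->.
Qed.

Lemma is_separated_prod X Y : is_separated X -> is_separated Y ->
  is_separated (prod_space X Y).
Proof.
move=> sX sY.
have m1 : morph (pair_map (fst \o fst) (fst \o snd)
    : prod_space (prod_space X Y) (prod_space X Y) -> prod_space X X).
  by apply: morph_pair; apply: morph_comp (@morph_fst _ _);
    [exact: morph_fst|exact: morph_snd].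
have m2 : morph (pair_map (snd \o fst) (snd \o snd)
    : prod_space (prod_space X Y) (prod_space X Y) -> prod_space Y Y).
  by apply: morph_pair; apply: morph_comp (@morph_snd _ _);
    [exact: morph_fst|exact: morph_snd].
have := closedI (closed_preim m1 sX) (closed_preim m2 sY); rewrite /is_separated.
congr (zclosed _); apply/seteqP; split=> -[[x y] [x' y']] /=.
  by rewrite /preimage /= => -[/= -> ->].
by rewrite /preimage /= => -[-> ->].
Qed.

Lemma is_separated_affine_space n : is_separated (affine_space n).
Proof.
apply: op_local => -[v w] vw.
have [i vwi] : exists i, v 0 i - w 0 i != 0.
  apply: contrapT => /forallNP h; apply: vw; apply/rowP => i.
  by apply/eqP; rewrite -subr_eq0; apply/negPn/negP/h.
pose h (p : prod_space (affine_space n) (affine_space n)) :=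
  (p.1 : 'rV[k]_n) 0 i - (p.2 : 'rV[k]_n) 0 i.
exists [set p | h p != 0]; split=> //.
  apply: regT_opN0; apply: reg_sub; first exact: opT.
    exact: reg_compT (@morph_fst _ _) (affine_reg_coord i).
  exact: reg_compT (@morph_snd _ _) (affine_reg_coord i).
by move=> [v' w'] /= /eqP hN0 e; apply: hN0; rewrite /h e subrr.
Qed.

Lemma is_variety_affine_space n : is_variety (affine_space n).
Proof.
split; last exact: is_separated_affine_space.
apply: is_prevariety_affine; exists n, setT; split; first exact: closedT.
exact: iso_sym (iso_subT _).
Qed.

Definition affine_var n : variety := Variety (is_variety_affine_space n).

Lemma is_variety_prod (X Y : variety) : is_variety (prod_space X Y).
Proof.
have [pX sX] := varP X; have [pY sY] := varP Y.
by split; [exact: is_prevariety_prod|exact: is_separated_prod].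
Qed.

Definition prod_var (X Y : variety) : variety := Variety (is_variety_prod X Y).

Lemma meval_homog n d (p : {mpoly k[n]}) c (v : 'rV[k]_n) :
  p \is d.-homog -> p.@[(c *: v) 0] = c ^+ d * p.@[v 0].
Proof.
move=> /dhomogP hp; rewrite !mevalE mulr_sumr big_seq [RHS]big_seq.
apply: eq_bigr => m mp; rewrite mulrCA; congr (_ * _).
have <- : mdeg m = d := hp _ mp.
rewrite mdegE -prodrXr -big_split /=.
by apply: eq_bigr => i _; rewrite mxE exprMn.
Qed.

Lemma hcoord_neq0 n (x : proj_pt n) : hcoord x != 0.
Proof.
rewrite /hcoord vpick0 -dimv_eq0; case: x => x /= /eqP ->.
by [].
Qed.

Lemma hcoord_line n (x : proj_pt n) (v : 'rV_n.+1) :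
  v \in val x -> v != 0 -> val x = <[v]>%VS.
Proof.
move=> vx v0; apply/esym/eqP; rewrite eqEdim dim_vline v0.
by rewrite -memvE vx /= (eqP (valP x)).
Qed.

Lemma hcoord_val n (x : proj_pt n) : val x = <[hcoord x]>%VS.
Proof. by apply: hcoord_line; [exact: memv_pick|exact: hcoord_neq0]. Qed.

Lemma dim_line1 n : \dim <[const_mx 1 : 'rV[k]_n.+1]>%VS == 1%N.
Proof.
rewrite dim_vline eqb1; apply/eqP => h.
have := congr1 (fun v : 'rV[k]_n.+1 => v 0 0) h; rewrite !mxE => /eqP.
by rewrite oner_eq0.
Qed.

(* The point with homogeneous coordinates v, for v nonzero. *)
Definition to_proj n (v : 'rV[k]_n.+1) : proj_pt n :=
  insubd (exist (fun x : {vspace 'rV[k]_n.+1} => \dim x == 1%N) _ (dim_line1 n)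
          : proj_pt n) <[v]>%VS.

Lemma to_projE n (v : 'rV_n.+1) : v != 0 -> val (to_proj v) = <[v]>%VS.
Proof. by move=> v0; rewrite /to_proj val_insubd dim_vline v0. Qed.

Lemma hcoord_to_proj n (v : 'rV_n.+1) : v != 0 ->
  exists2 c, c != 0 & hcoord (to_proj v) = c *: v.
Proof.
move=> v0; have := memv_pick (val (to_proj v)).
rewrite -/(hcoord _) to_projE // => /vlineP[c e]; exists c => //.
by apply: contra_neq (hcoord_neq0 (to_proj v)) => c0; rewrite e c0 scale0r.
Qed.

Lemma to_proj_eq n (v : 'rV_n.+1) (x : proj_pt n) c :
  c != 0 -> v = c *: hcoord x -> to_proj v = x.
Proof.
move=> c0 e.
have v0 : v != 0 by rewrite e scaler_eq0 negb_or c0 hcoord_neq0.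
apply: val_inj; rewrite to_projE //; apply/esym/hcoord_line => //.
by rewrite e memvZ // memv_pick.
Qed.

Lemma morph_proj (X : space) n (f : X -> 'rV[k]_n.+1) :
  (forall x, f x != 0) -> (forall i, reg setT (fun x => f x 0 i)) ->
  morph (fun x => to_proj (f x) : proj_space n).
Proof.
move=> f0 rf; apply: frac_morph => d p q [p' homp hp] [q' homq hq].
have rp : reg setT (fun x => p'.@[f x 0]) by exact/reg_meval/rf/opT.
have rq : reg setT (fun x => q'.@[f x 0]) by exact/reg_meval/rf/opT.
have oq := regT_opN0 rq.
have eN x : (q (to_proj (f x)) != 0) = (q'.@[f x 0] != 0).
  have [c c0 e] := hcoord_to_proj (f0 x).
  by rewrite hq e (meval_homog _ _ homq) mulf_eq0 expf_eq0 (negbTE c0) andbF.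
have -> : [set z | q (to_proj (f z)) != 0] = [set x | q'.@[f x 0] != 0].
  by apply/seteqP; split=> x /=; rewrite eN.
split=> //; apply: (@reg_ext _ _ (fun x => p'.@[f x 0] / q'.@[f x 0])).
  move=> x _; have [c c0 e] := hcoord_to_proj (f0 x).
  rewrite hp hq e (meval_homog _ _ homp) (meval_homog _ _ homq).
  by rewrite -mulf_div divff ?mul1r // expf_neq0.
by apply: reg_div => //; [apply: reg_res rp|apply: reg_res rq].
Qed.

Definition std_chart n (i : 'I_n.+1) : set (proj_space n) :=
  [set x | hcoord (x : proj_pt n) 0 i != 0].

Lemma form_fun_coord n (i : 'I_n.+1) :
  form_fun 1 (fun x : proj_pt n => hcoord x 0 i).
Proof.
exists 'X_i; first by rewrite dhomogX /= mdeg1.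
by move=> x; rewrite mevalXU.
Qed.

Lemma op_std_chart n i : op (@std_chart n i).
Proof. exact: frac_opN0 (form_fun_coord i). Qed.

Arguments op_std_chart {n} i.

Lemma std_chart_cover n (x : proj_space n) : exists i, std_chart i x.
Proof.
apply: contrapT => /forallNP h; have /eqP := hcoord_neq0 x; apply.
by apply/rowP => i; rewrite mxE; apply/eqP/negPn/negP/h.
Qed.

Lemma reg_std_chart n i j : reg (@std_chart n i)
  (fun x => hcoord (x : proj_pt n) 0 j / hcoord (x : proj_pt n) 0 i).
Proof. exact: frac_regQ (form_fun_coord j) (form_fun_coord i). Qed.

Arguments reg_std_chart {n} i j.

Lemma is_separated_proj_space n : is_separated (proj_space n).
Proof.
apply: op_local => -[x y] xy.
have [i xi] := std_chart_cover x; have [j yj] := std_chart_cover y.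
rewrite /std_chart /= in xi yj.
pose m (a b : 'rV[k]_n.+1) l := a 0 l / a 0 i * (b 0 i / b 0 j) - b 0 l / b 0 j.
have [l xyl] : exists l, m (hcoord x) (hcoord y) l != 0.
  apply: contrapT => /forallNP h; apply: xy => /=.
  have e l : hcoord y 0 l = hcoord y 0 i / hcoord x 0 i * hcoord x 0 l.
    have /negP/negPn := h l; rewrite /m subr_eq0 => /eqP.
    rewrite mulrA => /(mulIf _) <- //; last by rewrite invr_eq0.
    by rewrite mulrC mulrA [RHS]mulrAC.
  have e' : hcoord y = hcoord y 0 i / hcoord x 0 i *: hcoord x.
    by apply/rowP => l; rewrite mxE -e.
  rewrite -(@to_proj_eq _ (hcoord y) y 1) ?oner_neq0 ?scale1r //.
  apply/esym/(to_proj_eq _ e').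
  by apply: contra_neq (hcoord_neq0 y) => c0; rewrite e' c0 scale0r.
pose W : set (prod_space (proj_space n) (proj_space n)) :=
  fst @^-1` std_chart i `&` snd @^-1` std_chart j.
have oW : op W.
  apply: opI; [apply: (@morph_fst _ _).1|apply: (@morph_snd _ _).1];
    exact: op_std_chart.
have r1 l' : reg W (fun p => hcoord (p.1 : proj_pt n) 0 l' / hcoord (p.1 : proj_pt n) 0 i).
  apply: (@reg_res (prod_space (proj_space n) (proj_space n))
      (fst @^-1` std_chart i)) => //; first by move=> ? [].
  exact: (reg_comp (@morph_fst (proj_space n) (proj_space n))
    (op_std_chart i) (reg_std_chart i l')).
have r2 l' : reg W (fun p => hcoord (p.2 : proj_pt n) 0 l' / hcoord (p.2 : proj_pt n) 0 j).
  apply: (@reg_res (prod_space (proj_space n) (proj_space n))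
      (snd @^-1` std_chart j)) => //; first by move=> ? [].
  exact: (reg_comp (@morph_snd (proj_space n) (proj_space n))
    (op_std_chart j) (reg_std_chart j l')).
exists (W `&` [set p | m (hcoord p.1) (hcoord p.2) l != 0]); split.
- by apply: regN0 => //; apply: reg_sub => //; apply: regM.
- by [].
- move=> [a b] [[/= ai bj] /= /eqP h] e; apply: h.
  rewrite /preimage /std_chart /= -e in ai bj *.
  by rewrite /m mulrA divfK // subrr.
Qed.

Lemma is_prevariety_proj n (Z : set (proj_space n)) :
  zclosed Z -> is_prevariety (sub Z).
Proof.
move=> cZ; exists 'I_n.+1, (fun i => val @^-1` std_chart i).
split=> [i|x]; last exact: std_chart_cover.
split; first exact: (@morph_val _ _).1 (op_std_chart i).
pose C : set (affine_space n.+1) :=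
  [set w : 'rV[k]_n.+1 | w 0 i = 1 /\ Z (to_proj w)].
have C0 (w : 'rV[k]_n.+1) : w 0 i = 1 -> w != 0.
  move=> wi; apply/negP => /eqP w0; move: wi; rewrite w0 mxE => /eqP.
  by rewrite eq_sym oner_eq0.
exists n.+1, C; split.
  apply: op_local => w nC.
  have [wi|wi] := eqVneq (w 0 i) 1; last first.
    exists [set v : 'rV[k]_n.+1 | v 0 i - 1 != 0]; split; last 2 first.
    - by rewrite /= subr_eq0.
    - by move=> v /= vi [e _]; rewrite e subrr eqxx in vi.
    apply: regT_opN0; apply: reg_sub; first exact: opT.
      exact: affine_reg_coord.
    exact/reg_cst/opT.
  have nZ : (~` Z) (to_proj (w : 'rV[k]_n.+1)) by move=> Zw; apply: nC.
  have [d [q [[q' homq hq] qw qZ]]] := cZ _ nZ.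
  exists [set v : 'rV[k]_n.+1 | q'.@[v 0] != 0]; split.
  - exact: regT_opN0 (affine_reg q').
  - have [c c0 e] := hcoord_to_proj (C0 _ wi).
    move: qw; rewrite hq e (meval_homog _ _ homq) mulf_eq0 negb_or.
    by case/andP.
  - move=> v qv [vi Zv]; apply: (qZ (to_proj (v : 'rV[k]_n.+1))) => //.
    have [c c0 e] := hcoord_to_proj (C0 _ vi).
    by rewrite hq e (meval_homog _ _ homq) mulf_neq0 // expf_neq0.
pose S : set (sub Z) := val @^-1` std_chart i.
pose h (x : sub S) : 'rV[k]_n.+1 := hcoord (val (val x) : proj_pt n).
have hi x : h x 0 i != 0 by exact: (subP x).
pose f (x : sub S) : affine_space n.+1 := (h x 0 i)^-1 *: h x.
have tf x : to_proj (f x) = val (val x).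
  by apply: (@to_proj_eq _ _ _ (h x 0 i)^-1) => //; rewrite invr_eq0.
have hf x : C (f x).
  split; first by rewrite mxE mulVf.
  by rewrite tf; exact: subP.
have hg (w : sub C) : Z (to_proj (val w : 'rV[k]_n.+1)) by case: (subP w).
have hg' (w : sub C) : S (to_sub Z hg w).
  have [wi _] := subP w; rewrite /S /preimage /std_chart /=.
  have [c c0 ->] := hcoord_to_proj (C0 _ wi).
  by rewrite mxE wi mulr1.
exists (to_sub C hf), (to_sub S hg'); split.
- apply/morph_to_sub/morph_affine => j.
  apply: (@reg_ext _ _ (fun x => h x 0 j / h x 0 i)).
    by move=> x _; rewrite mxE mulrC.
  have mv : morph (fun x : sub S => val (val x) : proj_space n).
    exact: morph_comp (@morph_val _ _) (@morph_val _ _).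
  have := reg_comp mv (op_std_chart i) (reg_std_chart i j).
  by congr reg; apply/seteqP; split=> // x _; exact: (subP x).
- apply/morph_to_sub/morph_to_sub/morph_proj => [w|j].
    by have [wi _] := subP w; exact: C0.
  exact: reg_compT (@morph_val _ _) (affine_reg_coord j).
- by move=> x; do 2 apply: val_inj; rewrite /= tf.
- move=> w; apply: val_inj; rewrite /= /f /h /=.
  have [wi _] := subP w.
  have [c c0 ->] := hcoord_to_proj (C0 _ wi).
  by rewrite mxE wi mulr1 scalerA mulVf // scale1r.
Qed.

Lemma is_variety_proj n (Z : set (proj_space n)) :
  zclosed Z -> is_variety (sub Z).
Proof.
move=> cZ; split; first exact: is_prevariety_proj.
exact: is_separated_inj (@morph_val _ Z) val_inj (@is_separated_proj_space n).
Qed.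

Definition proj_zeros n (p : {mpoly k[n.+1]}) : set (proj_space n) :=
  [set x | p.@[hcoord (x : proj_pt n) 0] = 0].

Lemma zclosed_zeros n d (p : {mpoly k[n.+1]}) :
  p \is d.-homog -> zclosed (proj_zeros p).
Proof.
move=> hp x /eqP px; exists d, (fun x => p.@[hcoord x 0]).
by split=> //; [exists p|move=> y /eqP].
Qed.

Definition hypersurface n d (p : {mpoly k[n.+1]}) (hp : p \is d.-homog)
  : variety := Variety (is_variety_proj (zclosed_zeros hp)).

End Spaces.

(* Isomorphism classes of varieties form a set of the size of k: every variety
   is isomorphic to one whose points are finite sequences in k tagged with a
   natural number (the index of an affine chart).  K0 is generated by the
   varieties of this kind, which only serves to keep it in the universe of k;
   var_class below is defined on all varieties. *)
Section SmallVarieties.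
Variable k : closedFieldType.

Definition tagged_seq : Type := (nat * seq k)%type.

Record small_variety := SmallVariety {
  sv_pts : set tagged_seq;
  sv_str : structure k (set_type sv_pts);
  sv_varP : is_variety (Space sv_str) }.

Definition sv_var (X : small_variety) : variety k := Variety (sv_varP X).

Lemma is_variety_iso (X Y : space k) : iso X Y -> is_variety X -> is_variety Y.
Proof.
move=> [f [g [mf mg fg gf]]] [[I [U [hU cU]]] sX]; split; last first.
  exact: is_separated_inj mg (can_inj gf) sX.
exists I, (fun i => g @^-1` U i); split=> [i|y]; last exact: cU.
have [oU aU] := hU i; split; first exact: mg.1.
apply: is_affine_iso aU; apply: (iso_sub mf mg fg gf) => // x Ux.
by rewrite /preimage /= fg.
Qed.

Section Push.
Variables (X : space k) (T : Type) (h : X -> T).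

Definition push_op : set (set T) := [set W | op (h @^-1` W)].
Definition push_reg (W : set T) : set (T -> k) :=
  [set f | reg (h @^-1` W) (fun x => f (h x))].

Lemma push_opT : push_op setT. Proof. exact: (@opT k X). Qed.

Lemma push_opI U V : push_op U -> push_op V -> push_op (U `&` V).
Proof. exact: (@opI k X). Qed.

Lemma push_op_bigcup (F : set (set T)) :
  F `<=` push_op -> push_op (\bigcup_(U in F) U).
Proof.
move=> hF; apply: op_local => x [U FU Ux]; exists (h @^-1` U).
by split=> //; [exact: hF|move=> y Uy; exists U].
Qed.

Lemma push_reg_ext U f g :
  (forall x, U x -> f x = g x) -> push_reg U f -> push_reg U g.
Proof. by move=> fg; apply: reg_ext => x; exact: fg. Qed.

Lemma push_reg_res U V f : push_op V -> V `<=` U -> push_reg U f -> push_reg V f.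
Proof. by move=> oV VU; apply: reg_res => // x; exact: VU. Qed.

Lemma push_reg_glue U f : push_op U ->
  (forall x, U x -> exists V, [/\ push_op V, V x, V `<=` U & push_reg V f]) ->
  push_reg U f.
Proof.
move=> oU hU; apply: reg_glue => // x /hU[V [oV Vx VU rV]].
by exists (h @^-1` V); split=> // y; exact: VU.
Qed.

Lemma push_reg_cst U c : push_op U -> push_reg U (fun=> c).
Proof. exact: (@reg_cst k X). Qed.

Lemma push_regD U f g :
  push_reg U f -> push_reg U g -> push_reg U (fun x => f x + g x).
Proof. exact: (@regD k X). Qed.

Lemma push_regM U f g :
  push_reg U f -> push_reg U g -> push_reg U (fun x => f x * g x).
Proof. exact: (@regM k X). Qed.

Lemma push_reg_inv U f : push_op U -> push_reg U f ->
  push_op (U `&` [set x | f x != 0]) /\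
  push_reg (U `&` [set x | f x != 0]) (fun x => (f x)^-1).
Proof. exact: (@reg_inv k X). Qed.

Definition push : structure k T := Structure push_opT push_opI push_op_bigcup
  push_reg_ext push_reg_res push_reg_glue push_reg_cst push_regD push_regM
  push_reg_inv.

Lemma iso_push (h' : T -> X) : cancel h h' -> cancel h' h -> iso X (Space push).
Proof.
move=> hh' h'h; exists h, h'; split=> //.
have e V : h @^-1` (h' @^-1` V) = V.
  by apply/seteqP; split=> x; rewrite /preimage /= hh'.
split=> [V oV|V f oV rf].
  by rewrite /op /= /push_op /= e.
rewrite /reg /= /push_reg /= e; apply: reg_ext rf => x _ /=.
by rewrite hh'.
Qed.

End Push.

Lemma prevariety_inj (X : space k) :
  is_prevariety X -> exists e : X -> tagged_seq, injective e.
Proof.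
move=> [I [U [hU cU]]].
have /choice[c cP] i : exists c : X -> seq k,
    forall x y, U i x -> U i y -> c x = c y -> x = y.
  have [_ [n [Z [_ [f [g [_ _ fg _]]]]]]] := hU i.
  pose s (x : X) (Ux : U i x) : sub (U i) := exist _ x (mem_set Ux).
  pose c (x : X) : seq k := if pselect (U i x) is left Ux
    then [seq (val (f (s x Ux)) : 'rV[k]_n) 0 j | j <- enum 'I_n] else [::].
  exists c => x y Ux Uy; rewrite /c.
  case: pselect => [Ux'|//]; case: pselect => [Uy'|//] /eq_in_map e.
  have : f (s x Ux') = f (s y Uy').
    by apply: val_inj; apply/rowP => j; apply: e; rewrite mem_enum.
  by move=> /(can_inj fg) /(congr1 val).
have /choice[i iP] := cU.
exists (fun x => (enum_rank (i x) : nat, c (i x) x)) => x y [/val_inj].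
move=> /enum_rank_inj ei; rewrite ei; apply: cP => //; by rewrite -ei.
Qed.

Lemma small_modelP (X : variety k) : exists X' : small_variety, iso X (sv_var X').
Proof.
have [e eI] := prevariety_inj (varP X).1.
pose S : set tagged_seq := [set y | exists x, e x = y].
have hS x : S (e x) by exists x.
pose h (x : X) : set_type S := exist _ (e x) (mem_set (hS x)).
have h'P (y : set_type S) : exists x, h x = y.
  by case: (set_mem (valP y)) => x ex; exists x; apply: val_inj.
have [h' h'K] := choice h'P.
have hK : cancel h h' by move=> x; apply: eI; exact: (congr1 val (h'K (h x))).
have i := iso_push hK h'K.
by exists (SmallVariety (is_variety_iso i (varP X))).
Qed.

Definition small_model (X : variety k) : small_variety := sval (cid (small_modelP X)).

Lemma small_model_iso (X : variety k) : iso X (sv_var (small_model X)).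
Proof. exact: svalP (cid (small_modelP X)). Qed.

HB.instance Definition _ := gen_eqMixin small_variety.
HB.instance Definition _ := gen_choiceMixin small_variety.

End SmallVarieties.

Section GrothendieckRing.
Variable k : closedFieldType.

Notation freeVar := {freeg (small_variety k) / int}.

(* The subgroup generated by the relations.  In K0_rel_scissor, Y and U are the
   closed subvariety Z of X and its open complement. *)
Inductive K0_rel : freeVar -> Prop :=
| K0_rel_iso X Y : iso (sv_var X) (sv_var Y) -> K0_rel (<<X>> - <<Y>>)
| K0_rel_scissor X Y U (Z : set (sv_var X)) :
    zclosed Z -> iso (sv_var Y) (sub Z) -> iso (sv_var U) (sub (~` Z)) ->
    K0_rel (<<X>> - (<<Y>> + <<U>>))
| K0_rel0 : K0_rel 0
| K0_relB D E : K0_rel D -> K0_rel E -> K0_rel (D - E).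

Definition K0_pred : {pred freeVar} := fun D => `[< K0_rel D >].

Lemma K0_pred_closed : zmod_closed K0_pred.
Proof.
split; first by apply/asboolP; exact: K0_rel0.
by move=> D E /asboolP hD /asboolP hE; apply/asboolP; exact: K0_relB.
Qed.

HB.instance Definition _ :=
  GRing.isZmodClosed.Build freeVar K0_pred K0_pred_closed.

(* The abelian group generated by the isomorphism classes of varieties modulo
   the scissor relations.  See var_class_iso and var_class_scissor for the
   relations between arbitrary varieties, K0_lift for the universal property,
   and var_classM, var_class1 for the product. *)
Definition K0 : Type := Quotient.quot K0_pred.

HB.instance Definition _ := GRing.Zmodule.on K0.

Definition K0_proj (D : freeVar) : K0 := (\pi_(Quotient.quot K0_pred) D)%qT.

Lemma K0_projB D E : K0_proj (D - E) = K0_proj D - K0_proj E.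
Proof. by rewrite /K0_proj Quotient.pi_add Quotient.pi_opp. Qed.

Lemma K0_projK x : K0_proj (repr x) = x.
Proof. exact: reprK. Qed.

Lemma K0_projP D E : K0_proj D = K0_proj E <-> K0_rel (D - E).
Proof.
split=> [/eqP|h]; first by rewrite /K0_proj -Quotient.idealrBE => /asboolP.
by apply/eqP; rewrite /K0_proj -Quotient.idealrBE; apply/asboolP.
Qed.

Definition var_class (X : variety k) : K0 := K0_proj << small_model X >>.

Lemma var_class_sv X : var_class (sv_var X) = K0_proj << X >>.
Proof.
apply/K0_projP/K0_rel_iso.
exact: iso_sym (small_model_iso (sv_var X)).
Qed.

Lemma var_class_iso (X Y : variety k) : iso X Y -> var_class X = var_class Y.
Proof.
move=> XY; apply/K0_projP/K0_rel_iso.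
apply: iso_trans (iso_sym (small_model_iso X)) _.
exact: iso_trans XY (small_model_iso Y).
Qed.

Lemma K0_projD D E : K0_proj (D + E) = K0_proj D + K0_proj E.
Proof. by rewrite /K0_proj Quotient.pi_add. Qed.

Lemma var_class_scissor (X Y U : variety k) (Z : set X) :
  zclosed Z -> iso Y (sub Z) -> iso U (sub (~` Z)) ->
  var_class X = var_class Y + var_class U.
Proof.
move=> cZ YZ UZ; rewrite /var_class -K0_projD; apply/K0_projP.
have [f [g [mf mg fg gf]]] := small_model_iso X.
apply: (@K0_rel_scissor _ _ _ (g @^-1` Z)); first exact: closed_preim.
  apply: iso_trans (iso_sym (small_model_iso Y)) _; apply: iso_trans YZ _.
  by apply: (iso_sub mf mg fg gf) => // x; rewrite /preimage /= fg.
apply: iso_trans (iso_sym (small_model_iso U)) _; apply: iso_trans UZ _.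
by apply: (iso_sub mf mg fg gf) => // x; rewrite /preimage /setC /= fg.
Qed.

Lemma K0_ind (P : K0 -> Prop) :
  P 0 -> (forall x y, P x -> P y -> P (x - y)) -> (forall X, P (var_class X)) ->
  forall x, P x.
Proof.
move=> P0 PB Pc x; rewrite -(K0_projK x); move: (repr x) => D {x}.
have PN x : P x -> P (- x) by move=> Px; rewrite -[- x]add0r; exact: PB.
have PD x y : P x -> P y -> P (x + y).
  by move=> Px Py; rewrite -[y]opprK; apply: PB => //; exact: PN.
have K0_proj0 : K0_proj 0 = 0 by rewrite -[0]subr0 K0_projB subrr.
have Pn n X : P (K0_proj << n%:Z *g X >>).
  elim: n => [|n IH]; first by rewrite freegU0 K0_proj0.
  rewrite -addn1 PoszD -freegUD K0_projD; apply: PD => //.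
  by rewrite -var_class_sv.
elim/freeg_ind_dom0: D => [|c X D _ _ PX]; first by rewrite K0_proj0.
rewrite K0_projD; apply: PD => //.
case: c => n; first exact: Pn.
rewrite NegzE -freegUN -[- _]add0r K0_projB K0_proj0; exact: PB.
Qed.

Section Lift.
Variables (A : zmodType) (f : variety k -> A).

Definition free_lift (D : freeVar) : A :=
  fglift (fun X => f (sv_var X) : zmodule A) D.

Definition K0_lift (x : K0) : A := free_lift (repr x).

Lemma free_liftB D E : free_lift (D - E) = free_lift D - free_lift E.
Proof.
exact: (@lift_is_additive int _ (zmodule A) (fun X => f (sv_var X)) D E).
Qed.

Lemma free_lift0 : free_lift 0 = 0.
Proof. by rewrite -[0]subr0 free_liftB subrr. Qed.

Lemma free_liftD D E : free_lift (D + E) = free_lift D + free_lift E.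
Proof.
by rewrite -{1}[E]opprK free_liftB -[- E]add0r free_liftB free_lift0 sub0r opprK.
Qed.

Lemma free_liftU X : free_lift << X >> = f (sv_var X).
Proof. by rewrite /free_lift liftU scale1r. Qed.

Definition additive_invariant :=
  (forall X Y : variety k, iso X Y -> f X = f Y) /\
  (forall (X Y U : variety k) (Z : set X), zclosed Z -> iso Y (sub Z) ->
     iso U (sub (~` Z)) -> f X = f Y + f U).

Hypothesis hf : additive_invariant.

Lemma free_lift_rel D : K0_rel D -> free_lift D = 0.
Proof.
have [fi fs] := hf.
elim=> {D} [X Y XY|X Y U Z cZ YZ UZ||D E _ D0 _ E0].
- by rewrite free_liftB !free_liftU (fi _ _ XY) subrr.
- by rewrite free_liftB free_liftD !free_liftU (fs _ _ _ _ cZ YZ UZ) subrr.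
- exact: free_lift0.
- by rewrite free_liftB D0 E0 subrr.
Qed.

Lemma K0_lift_proj D : K0_lift (K0_proj D) = free_lift D.
Proof.
apply/eqP; rewrite -subr_eq0 -free_liftB; apply/eqP/free_lift_rel.
by apply/K0_projP; rewrite K0_projK.
Qed.

Lemma K0_liftB x y : K0_lift (x - y) = K0_lift x - K0_lift y.
Proof.
by rewrite -(K0_projK x) -(K0_projK y) -K0_projB !K0_lift_proj free_liftB.
Qed.

Lemma K0_lift_class X : K0_lift (var_class X) = f X.
Proof.
by rewrite K0_lift_proj free_liftU; apply/esym/hf.1; exact: small_model_iso.
Qed.

End Lift.

Lemma iso_sub_snd (X Y : space k) (S : set X) :
  iso (prod_space Y (sub S)) (sub (snd @^-1` S : set (prod_space Y X))).
Proof.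
apply: iso_trans (iso_prodC _ _) _; apply: iso_trans (iso_sub_fst _ _) _.
have mC (A B : space k) :
    morph (fun p : prod_space A B => (p.2, p.1) : prod_space B A).
  by apply: morph_pair; [exact: morph_snd|exact: morph_fst].
by apply: (iso_sub (@mC X Y) (@mC Y X)) => // -[].
Qed.

Lemma additive_invariant_prod (X : variety k) :
  additive_invariant (fun Y => var_class (prod_var X Y)).
Proof.
split=> [Y Y' YY'|Y Y' U Z cZ YZ UZ].
  by apply/var_class_iso/iso_prod => //; exact: iso_refl.
apply: (@var_class_scissor (prod_var X Y) (prod_var X Y') (prod_var X U)
  (snd @^-1` Z : set (prod_space X Y))).
- exact: closed_preim (@morph_snd _ _ _) cZ.
- exact: iso_trans (iso_prod (iso_refl X) YZ) (iso_sub_snd _ _).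
- exact: iso_trans (iso_prod (iso_refl X) UZ) (iso_sub_snd _ _).
Qed.

(* The additive extension, in both variables, of ([X], [Y]) |-> [X x Y]. *)
Definition K0_mul (x y : K0) : K0 :=
  K0_lift (fun X => K0_lift (fun Y => var_class (prod_var X Y)) y) x.

Lemma additive_invariant_mul y :
  additive_invariant (fun X => K0_lift (fun Y => var_class (prod_var X Y)) y).
Proof.
have hX X := additive_invariant_prod X.
split=> [X X' XX'|X X' U Z cZ XZ UZ]; elim/K0_ind: y => [|y z IHy IHz|Y].
- by rewrite -[0]subr0 !K0_liftB // !subrr.
- by rewrite !K0_liftB // IHy IHz.
- rewrite !K0_lift_class //; apply/var_class_iso/iso_prod => //; exact: iso_refl.
- by rewrite -[0]subr0 !K0_liftB // !subrr addr0.
- by rewrite !K0_liftB // IHy IHz opprD addrACA.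
- rewrite !K0_lift_class //.
  apply: (@var_class_scissor (prod_var X Y) (prod_var X' Y) (prod_var U Y)
    (fst @^-1` Z : set (prod_space X Y))).
  + exact: closed_preim (@morph_fst _ _ _) cZ.
  + exact: iso_trans (iso_prod XZ (iso_refl Y)) (iso_sub_fst _ _).
  + exact: iso_trans (iso_prod UZ (iso_refl Y)) (iso_sub_fst _ _).
Qed.

Lemma K0_mul_class (X Y : variety k) :
  K0_mul (var_class X) (var_class Y) = var_class (prod_var X Y).
Proof.
rewrite /K0_mul (K0_lift_class (additive_invariant_mul _)).
by rewrite (K0_lift_class (additive_invariant_prod X)).
Qed.

Lemma K0_mulBl x y z : K0_mul (x - y) z = K0_mul x z - K0_mul y z.
Proof. by rewrite /K0_mul (K0_liftB (additive_invariant_mul z)). Qed.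

Lemma K0_mulBr x y z : K0_mul x (y - z) = K0_mul x y - K0_mul x z.
Proof.
elim/K0_ind: x => [|x x' IH IH'|X].
- by rewrite -[0]subr0 !K0_mulBl !subrr.
- by rewrite !K0_mulBl IH IH' !opprB addrACA [RHS]addrACA (addrC (- K0_mul x z)).
- rewrite /K0_mul !(K0_lift_class (additive_invariant_mul _)).
  by rewrite (K0_liftB (additive_invariant_prod X)).
Qed.

Lemma K0_mul0l x : K0_mul 0 x = 0.
Proof. by rewrite -[0]subr0 K0_mulBl !subrr. Qed.

Lemma K0_mul0r x : K0_mul x 0 = 0.
Proof. by rewrite -[0]subr0 K0_mulBr !subrr. Qed.

Lemma K0_mulC : commutative K0_mul.
Proof.
move=> x y; elim/K0_ind: x => [|x x' IH IH'|X].
- by rewrite K0_mul0l K0_mul0r.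
- by rewrite K0_mulBl K0_mulBr IH IH'.
elim/K0_ind: y => [|y y' IH IH'|Y].
- by rewrite K0_mul0l K0_mul0r.
- by rewrite K0_mulBl K0_mulBr IH IH'.
by rewrite !K0_mul_class; apply/var_class_iso/iso_prodC.
Qed.

Lemma K0_mulA : associative K0_mul.
Proof.
move=> x y z; elim/K0_ind: x => [|x x' IH IH'|X].
- by rewrite !K0_mul0l.
- by rewrite !K0_mulBl IH IH'.
elim/K0_ind: y => [|y y' IH IH'|Y].
- by rewrite K0_mul0l !K0_mul0r K0_mul0l.
- by rewrite !(K0_mulBl, K0_mulBr) IH IH'.
elim/K0_ind: z => [|z z' IH IH'|Z].
- by rewrite !K0_mul0r.
- by rewrite !K0_mulBr IH IH'.
by rewrite !K0_mul_class; apply/var_class_iso/iso_prodA.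
Qed.

Definition K0_one : K0 := var_class (affine_var k 0).

Lemma K0_mul1 : left_id K0_one K0_mul.
Proof.
move=> x; elim/K0_ind: x => [|x x' IH IH'|X].
- by rewrite K0_mul0r.
- by rewrite K0_mulBr IH IH'.
by rewrite K0_mul_class; apply/var_class_iso/iso_prod1.
Qed.

Lemma K0_mulDl : left_distributive K0_mul +%R.
Proof.
move=> x y z; rewrite -{1}[y]opprK K0_mulBl -[- y]add0r K0_mulBl.
by rewrite K0_mul0l sub0r opprK.
Qed.

HB.instance Definition _ :=
  GRing.Zmodule_isComPzRing.Build K0 K0_mulA K0_mulC K0_mul1 K0_mulDl.

Lemma var_classM (X Y : variety k) : var_class (prod_var X Y) = var_class X * var_class Y.
Proof. by rewrite -K0_mul_class. Qed.

Lemma var_class1 : var_class (affine_var k 0) = 1.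
Proof. by []. Qed.

Definition lefschetz : K0 := var_class (affine_var k 1).

(* The ideal (L) of K0. *)
Definition lefschetz_ideal : set K0 := [set lefschetz * a | a in setT].

Definition L_rational (X : variety k) := lefschetz_ideal (var_class X - 1).

End GrothendieckRing.

(* Main.v *)
(* Let v be a zero of F, so that F(y + t v) = F(y) + t l(y) for a linear form l
   with l(v) = 0.  On the chart l = 1 the quadric is a graph: the zero of F on
   each line of direction v is unique, so the chart is isomorphic to the affine
   space {l = 1, y_i = 0}, where v_i != 0.  As n > 1, some nonzero translation
   acts on it, and a translation-invariant closed subset of an affine space is a
   product with A^1, hence of class in (L).  What remains, {F = l = 0}, is a cone
   with vertex v.  Cutting a cone successively by hyperplanes through its vertex
   removes charts invariant under translation by v, and leaves a point.  This
   covers l = 0 too, where the first chart is empty and the quadric is a cone. *)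
Require Import Defs.
From mathcomp Require Import all_boot all_order all_algebra.
From mathcomp Require Import boolp classical_sets mpoly.
From mathcomp Require Import ring.

Set Implicit Arguments.
Unset Strict Implicit.
Unset Printing Implicit Defensive.

Import GRing.Theory.
Local Open Scope ring_scope.

Section Quadrics.
Local Open Scope classical_set_scope.
Variable k : closedFieldType.

(** * Subspaces and closed subsets *)

(** The maps need to be mutually inverse only on [S] and [T]; the two slides along [v] used for the
    quadric are not inverse on the whole affine space. *)
Lemma iso_sub_on (X Y : Defs.space k) (f : X -> Y) (g : Y -> X)
    (S : set X) (T : set Y) :
  morph f -> morph g -> (forall x, S x -> T (f x)) -> (forall y, T y -> S (g y)) ->
  (forall x, S x -> g (f x) = x) -> (forall y, T y -> f (g y) = y) ->
  iso (sub S) (sub T).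
Proof.
move=> mf mg ST TS gf fg.
exists (to_sub (fun x : sub S => ST _ (subP x))).
exists (to_sub (fun y : sub T => TS _ (subP y))); split.
- apply: morph_to_sub; exact: morph_comp (@morph_val _ _ _) mf.
- apply: morph_to_sub; exact: morph_comp (@morph_val _ _ _) mg.
- by move=> x; apply: val_inj => /=; apply: gf; exact: subP.
- by move=> y; apply: val_inj => /=; apply: fg; exact: subP.
Qed.

Lemma iso_sub_sub (X : Defs.space k) (S T : set X) :
  iso (sub (S `&` T)) (sub (val @^-1` T : set (sub S))).
Proof.
have hS (x : sub (S `&` T)) : S (val x) by case: (subP x).
have hT (x : sub (S `&` T)) : (val @^-1` T) (to_sub hS x) by case: (subP x).
have hST (x : sub (val @^-1` T : set (sub S))) : (S `&` T) (val (val x)).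
  by split; [exact: subP (val x)|exact: (subP x)].
exists (to_sub (X := sub S) (S := val @^-1` T) hT), (to_sub hST); split.
- by do 2!apply: morph_to_sub; exact: morph_val.
- by apply: morph_to_sub; exact: morph_comp (@morph_val _ _ _) (@morph_val _ _ _).
- by move=> x; apply: val_inj.
- by move=> x; do 2!apply: val_inj.
Qed.

Lemma zclosed_reg0 (X : Defs.space k) (h : X -> k) :
  reg setT h -> zclosed [set x | h x = 0].
Proof.
move=> /regT_opN0; congr op; apply/seteqP; split=> x /=; first by move/eqP.
by move=> /eqP.
Qed.

Lemma is_variety_affine n (S : set (affine_space k n)) :
  zclosed S -> is_variety (sub S).
Proof.
move=> cS; split.
  apply: is_prevariety_affine; exists n, S; split=> //; exact: iso_refl.
exact: is_separated_inj (@morph_val _ _ S) val_inj (@is_separated_affine_space k n).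
Qed.

Lemma lefschetz_idealD (x y : K0 k) :
  lefschetz_ideal x -> lefschetz_ideal y -> lefschetz_ideal (x + y).
Proof. by move=> [a _ <-] [b _ <-]; exists (a + b) => //; rewrite mulrDr. Qed.

(** * Linear forms *)

(** The coefficients form a column, so that common zeros of several forms are the left kernel of a
    matrix. *)
Definition lform n (c : 'cV[k]_n) (y : 'rV[k]_n) : k := (y *m c) 0 0.

Lemma lformE n (c : 'cV[k]_n) y : lform c y = \sum_i c i 0 * y 0 i.
Proof. by rewrite /lform mxE; apply: eq_bigr => i _; rewrite mulrC. Qed.

Lemma lformD n (c : 'cV[k]_n) x y : lform c (x + y) = lform c x + lform c y.
Proof. by rewrite /lform mulmxDl mxE. Qed.

Lemma lformZ n (c : 'cV[k]_n) t y : lform c (t *: y) = t * lform c y.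
Proof. by rewrite /lform -scalemxAl mxE. Qed.

Definition lpoly n (c : 'cV[k]_n) : {mpoly k[n]} := \sum_i c i 0 *: 'X_i.

Lemma meval_lpoly n (c : 'cV[k]_n) (y : 'rV[k]_n) : (lpoly c).@[y 0] = lform c y.
Proof.
rewrite /lpoly lformE raddf_sum; apply: eq_bigr => i _ /=.
by rewrite mevalZ mevalXU.
Qed.

Lemma lpoly_homog n (c : 'cV[k]_n) : lpoly c \is 1.-homog.
Proof. by apply: rpred_sum => i _; rewrite dhomogZ // dhomogX /= mdeg1. Qed.

Lemma reg_lform n (c : 'cV[k]_n) :
  reg (setT : set (affine_space k n)) (fun y => lform c y).
Proof. by apply: reg_ext (affine_reg (lpoly c)) => y _; rewrite meval_lpoly. Qed.

(** * Translations of affine space *)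

(** The amount [h y] varies with the point, which covers projections along [v] as well as graphs
    over a hyperplane. *)
Lemma morph_translate n (h : affine_space k n -> k) (v : 'rV[k]_n) :
  reg setT h -> morph (fun y : affine_space k n => y + h y *: v : affine_space k n).
Proof.
move=> rh; apply: morph_affine => i.
apply: (@reg_ext _ _ _ (fun y : affine_space k n => y 0 i + h y * v 0 i)).
  by move=> y _; rewrite !mxE.
apply: regD; first exact: affine_reg_coord.
by apply: regM => //; apply/reg_cst/opT.
Qed.

(** Sliding along [u] to the hyperplane [y_j = 0], where [u_j != 0], splits [S] as the product of
    A^1 and [S]&[H], so its class is a multiple of L. *)
Lemma translation_invariant_class n (S : set (affine_space k n))
    (cS : zclosed S) (u : 'rV[k]_n) :
  u != 0 -> (forall (y : 'rV[k]_n) t, S y -> S (y + t *: u)) ->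
  lefschetz_ideal (var_class (Variety (is_variety_affine cS))).
Proof.
move=> u0 uS; have [j uj] : exists j, u 0 j != 0.
  by move/rV0Pn: u0.
pose H : set (affine_space k n) := [set y : 'rV[k]_n | y 0 j = 0].
have cT : zclosed (S `&` H) by apply: closedI cS _; apply/zclosed_reg0/affine_reg_coord.
exists (var_class (Variety (is_variety_affine cT))) => //.
rewrite -var_classM; apply/var_class_iso/iso_sym => /=.
(* [h y] is the only [t] for which [y + t *: u] has zero [j]-th coordinate. *)
pose h (y : 'rV[k]_n) := - (y 0 j / u 0 j).
have rh : reg (setT : set (affine_space k n)) h.
  apply: (@reg_ext _ _ _ (fun y : affine_space k n => - (u 0 j)^-1 * y 0 j)).
    by move=> y _; rewrite /h mulNr mulrC.
  by apply: regM; [apply/reg_cst/opT|exact: affine_reg_coord].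
have hT (y : sub S) : (S `&` H) ((val y : 'rV[k]_n) + h (val y) *: u).
  split; first by apply: uS; exact: subP.
  by rewrite /H /= !mxE /h mulNr divfK // subrr.
have hS (p : prod_space (affine_space k 1) (sub (S `&` H))) :
    S ((val p.2 : 'rV[k]_n) + (p.1 : 'rV[k]_1) 0 0 *: u).
  by apply: uS; case: (subP p.2).
exists (pair_map (fun y : sub S => const_mx (- h (val y)) : affine_space k 1)
         (to_sub hT)).
exists (to_sub hS); split.
- apply: morph_pair; last first.
    apply: morph_to_sub; exact: morph_comp (@morph_val _ _ _) (morph_translate u rh).
  apply: morph_affine => i.
  apply: (@reg_ext _ _ _ (fun y : sub S => -1 * h (val y))).
    by move=> y _; rewrite mxE mulN1r.
  apply: regM; first exact/reg_cst/opT.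
  exact: reg_compT (@morph_val _ _ S) rh.
- apply/morph_to_sub/morph_affine => i.
  apply: (@reg_ext _ (prod_space (affine_space k 1) (sub (S `&` H))) _ (fun p =>
    (val p.2 : 'rV[k]_n) 0 i + (p.1 : 'rV[k]_1) 0 0 * u 0 i)).
    by move=> p _; rewrite !mxE.
  apply: regD.
    apply: (reg_compT _ (affine_reg_coord i)).
    exact: morph_comp (@morph_snd _ _ _) (@morph_val _ _ _).
  apply: regM; last exact/reg_cst/opT.
  exact: reg_compT (@morph_fst _ _ _) (affine_reg_coord 0).
- by move=> y; apply: val_inj; rewrite /= mxE /h opprK scaleNr subrK.
- move=> [t y]; have [Sy /= yj] := subP y.
  have e : h ((val y : 'rV[k]_n) + (t : 'rV[k]_1) 0 0 *: u) = - (t : 'rV[k]_1) 0 0.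
    by rewrite /h !mxE yj add0r mulfK.
  rewrite /pair_map /=; congr pair.
    by rewrite e opprK; apply/rowP => i; rewrite mxE ord1.
  by apply: val_inj; rewrite /= e scaleNr addrK.
Qed.

(** * Hyperplane sections and affine charts in projective space *)

Section Projective.
Variable n : nat.
Notation P := (proj_space k n).
Notation A := (affine_space k n.+1).
Implicit Types (Z : set P) (c : 'cV[k]_n.+1) (v y : 'rV[k]_n.+1).

Lemma lform_neq0 c y : lform c y != 0 -> y != 0.
Proof. by apply: contra_neq => ->; rewrite /lform mul0mx mxE. Qed.

Lemma lform1_neq0 c y : lform c y = 1 -> y != 0.
Proof. by move=> e; apply: (@lform_neq0 c); rewrite e oner_neq0. Qed.

Lemma proj_zeros_to_proj d (p : {mpoly k[n.+1]}) y : p \is d.-homog -> y != 0 ->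
  proj_zeros p (to_proj y) <-> p.@[y 0] = 0.
Proof.
move=> hp y0; have [a a0 e] := hcoord_to_proj y0.
rewrite /proj_zeros /= e (meval_homog _ _ hp); split=> [/eqP|->]; last by rewrite mulr0.
by rewrite mulf_eq0 expf_eq0 (negbTE a0) andbF => /eqP.
Qed.

Definition hyperplane c : set P := proj_zeros (lpoly c).

Lemma hyperplane_to_proj c y : y != 0 -> hyperplane c (to_proj y) <-> lform c y = 0.
Proof. by rewrite -meval_lpoly; exact/proj_zeros_to_proj/lpoly_homog. Qed.

Lemma hyperplane_hcoord c (x : P) :
  hyperplane c x <-> lform c (hcoord (x : proj_pt k n)) = 0.
Proof. by rewrite /hyperplane /proj_zeros /= meval_lpoly. Qed.

Lemma zclosed_hyperplane c : zclosed (hyperplane c).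
Proof. exact/zclosed_zeros/lpoly_homog. Qed.

(* The affine chart [c != 0] of Z, normalised by [c = 1]. *)
Definition chart Z c : set A := [set y : 'rV[k]_n.+1 | lform c y = 1 /\ Z (to_proj y)].

Lemma zclosed_chart Z c : zclosed Z -> zclosed (chart Z c).
Proof.
move=> cZ; apply: op_local => y nC.
have [y1|y1] := eqVneq (lform c y) 1; last first.
  exists [set z : 'rV[k]_n.+1 | lform c z - 1 != 0]; split.
  - apply: regT_opN0; apply: reg_sub; first exact: opT.
      exact: reg_lform.
    exact/reg_cst/opT.
  - by rewrite /= subr_eq0.
  - by move=> z /= z1 [e _]; rewrite e subrr eqxx in z1.
(* Some form is nonzero at this point and vanishes on [Z]; its nonvanishing does not depend on the
   scaling of coordinates, so it also separates [y] from the chart. *)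
have nZ : (~` Z) (to_proj (y : 'rV[k]_n.+1)) by move=> Zy; apply: nC.
have [d [q [[q' hq' qE] qy qZ]]] := cZ _ nZ.
have q'N0 (z : 'rV[k]_n.+1) : z != 0 -> (q (to_proj z) != 0) = (q'.@[z 0] != 0).
  move=> z0; have [a a0 e] := hcoord_to_proj z0.
  by rewrite qE e (meval_homog _ _ hq') mulf_eq0 expf_eq0 (negbTE a0) andbF.
exists [set z : 'rV[k]_n.+1 | q'.@[z 0] != 0]; split.
- exact: regT_opN0 (affine_reg q').
- by rewrite /= -q'N0 // (lform1_neq0 y1).
- by move=> z qz [z1 Zz]; apply: (qZ (to_proj z)); rewrite ?q'N0 // (lform1_neq0 z1).
Qed.

(** A line on which [c] is not zero has exactly one representative with [c = 1]; its coordinates are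
    quotients of forms of degree 1, hence regular. *)
Lemma iso_chart Z c : iso (sub (chart Z c)) (sub (Z `&` ~` hyperplane c)).
Proof.
have hZ (y : sub (chart Z c)) :
    (Z `&` ~` hyperplane c) (to_proj (val y : 'rV[k]_n.+1)).
  have [y1 Zy] := subP y; split=> //.
  move=> /(hyperplane_to_proj _ (lform1_neq0 y1)); rewrite y1.
  by apply/eqP/oner_neq0.
pose h (x : sub (Z `&` ~` hyperplane c)) : 'rV[k]_n.+1 := hcoord (val x : proj_pt k n).
have h0 x : lform c (h x) != 0.
  by apply/eqP => e; have [_] := subP x; apply; apply/hyperplane_hcoord.
have hC (x : sub (Z `&` ~` hyperplane c)) : chart Z c ((lform c (h x))^-1 *: h x).
  split; first by rewrite lformZ mulVf.
  rewrite (@to_proj_eq _ _ _ (val x) (lform c (h x))^-1) ?invr_eq0 //.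
  by case: (subP x).
exists (to_sub hZ), (to_sub hC); split.
- apply/morph_to_sub/morph_proj => [y|j]; first by have [/lform1_neq0] := subP y.
  exact: reg_compT (@morph_val _ _ _) (affine_reg_coord j).
- apply/morph_to_sub/morph_affine => j.
  apply: (@reg_ext _ _ _ (fun x => h x 0 j / lform c (h x))).
    by move=> x _; rewrite mxE mulrC.
  have fc : form_fun 1 (fun x : proj_pt k n => lform c (hcoord x)).
    by exists (lpoly c); [exact: lpoly_homog|move=> x; rewrite meval_lpoly].
  have r := frac_regQ (gR := form_fun_graded k n) (form_fun_coord k j) fc.
  have o := frac_opN0 (gR := form_fun_graded k n) fc.
  have := reg_comp (@morph_val _ P (Z `&` ~` hyperplane c)) o r.
  by congr reg; apply/seteqP; split=> // x _; exact: h0.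
- move=> y; have [y1 Zy] := subP y; apply: val_inj => /=; rewrite /h /=.
  have [a a0 ->] := hcoord_to_proj (lform1_neq0 y1).
  by rewrite lformZ y1 mulr1 scalerA mulVf // scale1r.
- move=> x; apply: val_inj => /=.
  by apply: (@to_proj_eq _ _ _ (val x) (lform c (h x))^-1); rewrite ?invr_eq0.
Qed.

(** The chart enters only up to isomorphism, so that for the quadric it can be replaced by an affine
    linear space [S]. *)
Lemma hyperplane_scissor Z c (cZ : zclosed Z) (cZc : zclosed (Z `&` hyperplane c))
    (S : set A) (cS : zclosed S) : iso (sub S) (sub (chart Z c)) ->
  var_class (Variety (is_variety_proj cZ)) =
  var_class (Variety (is_variety_proj cZc)) + var_class (Variety (is_variety_affine cS)).
Proof.
move=> iS; pose H : set (sub Z) := val @^-1` hyperplane c.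
have cH : zclosed H by exact: closed_preim (morph_val Z) (zclosed_hyperplane (c := c)).
have iY : iso (sub (Z `&` hyperplane c)) (sub H) by exact: iso_sub_sub.
have iU : iso (sub S) (sub (~` H)).
  apply: iso_trans iS (iso_trans (iso_chart Z c) _).
  exact: (iso_sub_sub Z (~` hyperplane c)).
exact: (@var_class_scissor _ (Variety (is_variety_proj cZ))
  (Variety (is_variety_proj cZc)) (Variety (is_variety_affine cS)) H cH iY iU).
Qed.

Lemma L_rational_point v (cZ : zclosed [set to_proj v : P]) :
  L_rational (Variety (is_variety_proj cZ)).
Proof.
exists 0 => //; rewrite mulr0; apply/esym/eqP; rewrite subr_eq0 -var_class1.
apply/eqP/var_class_iso => /=.
pose pt : sub [set to_proj v : P] := exist _ (to_proj v : P) (mem_set (erefl _)).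
exists (fun=> 0 : affine_space k 0), (fun=> pt); split; try exact: morph_cst.
  by move=> x; apply: val_inj; rewrite /= (subP x).
by move=> y; apply/rowP => -[].
Qed.

(** * Cones *)

(** The vectors are kept nonzero because [to_proj] takes a default value at 0. *)
Definition cone_at v Z := forall y t,
  y != 0 -> y + t *: v != 0 -> Z (to_proj y) -> Z (to_proj (y + t *: v)).

Lemma cone_at_hyperplane v Z c : lform c v = 0 -> cone_at v Z ->
  cone_at v (Z `&` hyperplane c).
Proof.
move=> cv hv y t y0 yt0 [Zy Hy]; split; first exact: hv.
apply/hyperplane_to_proj => //; rewrite lformD lformZ cv mulr0 addr0.
exact/hyperplane_to_proj.
Qed.

(* Each hyperplane through the vertex v removes an affine chart on which
   translation along v acts; enough of them leave only the vertex. *)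
Lemma L_rational_cone v Z (cZ : zclosed Z) : v != 0 -> Z (to_proj v) ->
  cone_at v Z -> L_rational (Variety (is_variety_proj cZ)).
Proof.
move=> v0.
(* Induction on a list of forms that vanish at [v] and whose only common zero in [Z] is the
   vertex. *)
suff ind (s : seq 'cV[k]_n.+1) : (forall c, c \in s -> lform c v = 0) ->
    forall Z (cZ : zclosed Z), Z (to_proj v) -> cone_at v Z ->
    (forall x, Z x -> (forall c, c \in s -> hyperplane c x) -> x = to_proj v) ->
    L_rational (Variety (is_variety_proj cZ)).
  (* The columns of [cokermx v] are linear forms whose common zeros are the multiples of [v]. *)
  move=> Zv hv; apply: (ind [seq col j (cokermx v) | j <- enum 'I_n.+1]) => //.
    move=> _ /mapP[j _ ->]; rewrite /lform colE mulmxA.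
    by rewrite (eqP (_ : v *m cokermx v == 0)) -?submxE ?submx_refl // mul0mx mxE.
  move=> x _ hx; pose y : 'rV[k]_n.+1 := hcoord (x : proj_pt k n).
  have /sub_rVP[a ya] : (y <= v)%MS.
    rewrite submxE; apply/eqP/rowP => j; rewrite [RHS]mxE.
    have /hx/hyperplane_hcoord : col j (cokermx v) \in
        [seq col j (cokermx v) | j <- enum 'I_n.+1].
      by apply/mapP; exists j; rewrite ?mem_enum.
    by rewrite /lform colE mulmxA -colE mxE => ->.
  have a0 : a != 0.
    apply: contra_neq (hcoord_neq0 (x : proj_pt k n)) => a0.
    by rewrite -/y ya a0 scale0r.
  apply/esym/(@to_proj_eq _ _ _ _ a^-1); first by rewrite invr_eq0.
  by rewrite -/y ya scalerA mulVf // scale1r.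
elim: s => [|c s IH] sv {}Z {}cZ Zv hv hs.
  have e : Z = [set to_proj v : P].
    by apply/seteqP; split=> x; [move=> /hs; apply|move=> ->].
  by subst Z; exact: L_rational_point.
have cv : lform c v = 0 by apply: sv; rewrite mem_head.
have cZc := closedI cZ (zclosed_hyperplane (c := c)).
rewrite /L_rational (hyperplane_scissor cZ cZc (zclosed_chart (c := c) cZ) (iso_refl _)).
rewrite addrAC; apply: lefschetz_idealD.
  apply: IH.
  - by move=> b bs; apply: sv; rewrite inE bs orbT.
  - by split=> //; apply/hyperplane_to_proj.
  - exact: cone_at_hyperplane.
  - move=> x [Zx xc] hx; apply: hs => // b; rewrite inE => /orP[/eqP -> //|].
    exact: hx.
apply: (translation_invariant_class _ v0) => y t [y1 Zy].
have yt1 : lform c (y + t *: v) = 1 by rewrite lformD lformZ cv mulr0 addr0.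
by split=> //; apply: hv => //; [exact: lform1_neq0 y1|exact: lform1_neq0 yt1].
Qed.

End Projective.

(** * Quadratic forms *)

(** A monomial of degree 2 is a product of two variables, given by a matrix unit. [B] is not asked
    to be symmetric, so nothing is divided by 2. *)
Lemma quadratic_form_mx n (F : {mpoly k[n]}) : F \is 2.-homog ->
  exists B : 'M[k]_n, forall y : 'rV[k]_n, F.@[y 0] = (y *m B *m y^T) 0 0.
Proof.
move=> /dhomogP hF.
have hX (m : 'X_{1..n}) : mdeg m = 2 -> exists B : 'M[k]_n,
    forall y : 'rV[k]_n, ('X_[m] : {mpoly k[n]}).@[y 0] = (y *m B *m y^T) 0 0.
  move=> m2; have [i mi] : exists i, m i != 0%N.
    apply: contrapT => /forallNP h; move: m2; rewrite mdegE big1 // => i _.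
    by apply/eqP/negPn/negP/h.
  have le : (U_(i) <= m)%MM by rewrite lep1mP.
  have /mdeg1P[j /eqP mj] : mdeg (m - U_(i))%MM == 1%N.
    by rewrite -(eqn_add2r 1) -{1}(mdeg1 i) -mdegD submK // m2.
  exists (delta_mx j i) => y.
  rewrite -(submK le) mj mpolyXD mevalM !mevalXU.
  rewrite -(mul_delta_mx (0 : 'I_1)) mulmxA -mulmxA -colE -rowE.
  by rewrite mxE big_ord1 !mxE.
rewrite (mpolyE F) big_seq.
elim/big_ind: _ => [|p q [B hB] [C hC]|m mF].
- by exists 0 => y; rewrite meval0 mulmx0 mul0mx mxE.
- by exists (B + C) => y; rewrite mevalD hB hC mulmxDr mulmxDl [RHS]mxE.
- have [B hB] := hX m (hF _ mF); exists (F@_m *: B) => y.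
  by rewrite mevalZ hB -scalemxAr -scalemxAl [RHS]mxE.
Qed.

(** [lform c] is the polar form of [F] at [v]. *)
Lemma quadratic_form_line n (F : {mpoly k[n]}) (v : 'rV[k]_n) : F \is 2.-homog ->
  exists c : 'cV[k]_n, forall (y : 'rV[k]_n) t,
    F.@[(y + t *: v) 0] = F.@[y 0] + t * lform c y + t ^+ 2 * F.@[v 0].
Proof.
move=> /quadratic_form_mx[B hB]; exists ((B + B^T) *m v^T) => y t.
rewrite !hB /lform linearD linearZ /= !mulmxDl !mulmxDr -!scalemxAl -!scalemxAr.
(* A 1 by 1 matrix equals its transpose. *)
have -> : y *m (B^T *m v^T) = v *m B *m y^T.
  have <- : (v *m B *m y^T)^T = v *m B *m y^T.
    by apply/matrixP => i j; rewrite [LHS]mxE !ord1.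
  by rewrite !trmx_mul trmxK.
rewrite !mulmxA.
have entryD (M N : 'M[k]_1) : (M + N) 0 0 = M 0 0 + N 0 0 by rewrite mxE.
have entryZ a (M : 'M[k]_1) : (a *: M) 0 0 = a * M 0 0 by rewrite mxE.
rewrite !(entryD, entryZ); ring.
Qed.

(** If [F] is nonzero at [e0], then on the line [e1 + t *: e0] it is a polynomial of degree 2 in
    [t], which has a root in [k]. *)
Lemma quadratic_form_zero n (F : {mpoly k[n.+2]}) : F \is 2.-homog ->
  exists2 v : 'rV[k]_n.+2, v != 0 & F.@[v 0] = 0.
Proof.
move=> hF; pose e0 : 'rV[k]_n.+2 := delta_mx 0 0.
pose e1 : 'rV[k]_n.+2 := delta_mx 0 (lift 0 0).
have [F0|F0] := eqVneq F.@[e0 0] 0.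
  exists e0 => //; apply/rV0Pn; exists 0; by rewrite mxE !eqxx oner_neq0.
have [c hc] := quadratic_form_line e0 hF.
pose p := F.@[e1 0]%:P + (lform c e1)%:P * 'X + F.@[e0 0]%:P * 'X^2.
have /closed_rootP[t /rootP pt] : size p != 1%N.
  have p2 : p`_2 = F.@[e0 0] by rewrite /p !coefE /= !mulr0 !add0r mulr1.
  by apply: contra_neq F0 => p1; rewrite -p2 nth_default // p1.
exists (e1 + t *: e0).
  apply/rV0Pn; exists (lift 0 0).
  by rewrite !mxE !eqxx /= mulr0 addr0 oner_neq0.
by rewrite hc -pt /p !hornerE /=; ring.
Qed.

(** The two columns have rank at most 2, so more than two rows leave a nonzero left kernel. *)
Lemma lform_kernel n (b c : 'cV[k]_n) : (2 < n)%N ->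
  exists2 u : 'rV[k]_n, u != 0 & lform b u = 0 /\ lform c u = 0.
Proof.
move=> n2; pose K := kermx (row_mx b c).
have K0 : K != 0.
  rewrite -mxrank_eq0 mxrank_ker subn_eq0 -ltnNge.
  exact: leq_ltn_trans (rank_leq_col _) n2.
have [u /sub_kermxP uK u0] := rowV0Pn K0; exists u => //.
rewrite mul_mx_row -row_mx0 in uK.
have [ub uc] := eq_row_mx uK.
by rewrite /lform ub uc !mxE.
Qed.

(** * Quadric hypersurfaces *)

Lemma L_rational_quadric n (F : {mpoly k[n.+1]}) (hF : F \is 2.-homog) :
  (1 < n)%N -> L_rational (hypersurface hF).
Proof.
case: n F hF => // n F hF n1.
have [v v0 Fv] := quadratic_form_zero hF.
have /rV0Pn[i vi] := v0.
have [c hc] := quadratic_form_line v hF.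
have {}hc y t : F.@[(y + t *: v) 0] = F.@[y 0] + t * lform c y.
  by rewrite hc Fv mulr0 addr0.
have cv : lform c v = 0.
  (* At [y = v], [t = 1] this compares [F(2v) = 4 F(v) = 0] with [F(v) + lform c v]. *)
  have := hc v 1.
  by rewrite -{1}(scale1r v) -scalerDl (meval_homog _ _ hF) Fv mulr0 mul1r add0r.
set Z := proj_zeros F.
have cZ : zclosed Z := zclosed_zeros hF.
have cZc := closedI cZ (zclosed_hyperplane (c := c)).
pose A := affine_space k n.+2.
(* As [v_i != 0], [W] meets each line of direction [v] in [c = 1] exactly once. *)
pose W : set A :=
  [set y : 'rV[k]_n.+2 | lform c y - 1 = 0] `&` [set y : 'rV[k]_n.+2 | y 0 i = 0].
have cW : zclosed W.
  apply: closedI; apply: zclosed_reg0; last exact: affine_reg_coord.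
  by apply: reg_sub; [exact: opT|exact: reg_lform|exact/reg_cst/opT].
have chartE y : chart Z c y <-> lform c y = 1 /\ F.@[y 0] = 0.
  by split=> -[y1 Fy]; split=> //; apply/(proj_zeros_to_proj hF (lform1_neq0 y1)).
have iW : iso (sub W) (sub (chart Z c)).
  (* On [c = 1] one has [F(y + t v) = F(y) + t], so [f] slides to the zero of [F], while [g] slides
     back to [y_i = 0]. *)
  pose f (y : A) : A := y + (- F.@[y 0]) *: v.
  pose g (y : A) : A := y + (- (y 0 i / v 0 i)) *: v.
  apply: (@iso_sub_on A A f g).
  - apply: morph_translate.
    by apply: reg_ext (affine_reg (- F)) => y _; rewrite mevalN.
  - apply: morph_translate.
    apply: (@reg_ext _ _ _ (fun y : A => - (v 0 i)^-1 * y 0 i)).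
      by move=> y _; rewrite mulNr mulrC.
    by apply: regM; [apply/reg_cst/opT|exact: affine_reg_coord].
  - move=> y [/eqP]; rewrite subr_eq0 => /eqP y1 yi; apply/chartE.
    by rewrite hc lformD lformZ cv y1 mulr0 addr0 mulr1 subrr.
  - move=> y /chartE[y1 Fy]; split=> /=.
      by rewrite lformD lformZ cv y1 mulr0 addr0 subrr.
    by rewrite !mxE mulNr divfK // subrr.
  - move=> y [/eqP]; rewrite subr_eq0 => /eqP y1 /= yi.
    by rewrite /g /f !mxE yi add0r mulfK // opprK scaleNr subrK.
  - move=> y /chartE[y1 Fy]; rewrite /f /g hc Fy y1 mulr1 add0r opprK.
    by rewrite scaleNr subrK.
(* [delta_mx i 0] is the [i]-th coordinate form, so translation by [u] preserves [W]. There are more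
   than two coordinates because [n > 1]. *)
have [u u0 [cu ui]] := lform_kernel c (delta_mx i 0) n1.
have := hyperplane_scissor cZ cZc cW iW.
rewrite /L_rational.
have -> : hypersurface hF = Variety (is_variety_proj cZ).
  by congr Variety; exact: Prop_irrelevance.
move=> ->; rewrite addrAC; apply: lefschetz_idealD.
  (* Where [c = 0], [F] is constant along [v], so what remains is a cone with vertex [v]. *)
  apply: (L_rational_cone _ v0); first split.
  - exact/(proj_zeros_to_proj hF v0).
  - exact/hyperplane_to_proj.
  - move=> y t y0 yt0 [/(proj_zeros_to_proj hF y0) Fy /(hyperplane_to_proj _ y0) cy].
    split; first by apply/(proj_zeros_to_proj hF yt0); rewrite hc Fy cy mulr0 addr0.
    by apply/hyperplane_to_proj; rewrite // lformD lformZ cv cy mulr0 addr0.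
apply: (translation_invariant_class _ u0) => y t [/= y1 yi]; split=> /=.
  by rewrite lformD lformZ cu mulr0 addr0.
have {}ui : u 0 i = 0 by rewrite -ui /lform -colE mxE.
by rewrite !mxE yi ui mulr0 addr0.
Qed.

End Quadrics.

Theorem proposition2p2 (k : closedFieldType) (hk : [pchar k] =i pred0)
  (n : nat) (hn : (1 < n)%N) (F : {mpoly k[n.+1]}) (hF0 : F != 0)
  (hF : F \is 2.-homog) :
  L_rational (hypersurface hF).
Proof. exact: L_rational_quadric. Qed.
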